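(* Consider the Rescaled Pólya urn with $k\ge2$ colors and parameters $\alpha>0$ and $\beta>1$, and let $$\boldsymbol{\psi}_\infty=\frac{\boldsymbol{B}_0+\alpha\sum_{n=1}^{+\infty}\beta^{-n}\boldsymbol{\xi}_n}{|\boldsymbol{B}_0|+\frac{\alpha}{\beta-1}}$$ (the almost sure limit of $\boldsymbol{\psi}_N$). Then, as $N\to\infty$, $\overline{\boldsymbol{\xi}}_N\to\boldsymbol{\psi}_\infty$ almost surely and $$\sqrt N\,(\overline{\boldsymbol{\xi}}_N-\boldsymbol{\psi}_N)\ \xrightarrow{\ s\ }\ \mathcal{N}(\boldsymbol{0},\Sigma^2)\qquad\text{and}\qquad \sqrt N\,(\overline{\boldsymbol{\xi}}_N-\boldsymbol{\psi}_\infty)\ \xrightarrow{\ s\ }\ \mathcal{N}(\boldsymbol{0},\Sigma^2),$$ where $\Sigma^2=\mathrm{diag}(\boldsymbol{\psi}_\infty)-\boldsymbol{\psi}_\infty\boldsymbol{\psi}_\infty^\top$ (a random matrix) and $\xrightarrow{s}$ denotes stable convergence.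
   Context: For $x\in\mathbb{R}^k$, $|x|=\sum_{i=1}^k|x_i|$; $e_1,\dots,e_k$ is the canonical basis of $\mathbb{R}^k$. Rescaled Pólya (RP) urn with $k$ colors and parameters $\alpha,\beta$: let $\boldsymbol{b}_0=(b_{0,1},\dots,b_{0,k})^\top$ and $\boldsymbol{B}_0=(B_{0,1},\dots,B_{0,k})^\top$ be deterministic vectors with nonnegative real entries such that $|\boldsymbol{b}_0|>0$ and $b_{0,i}+B_{0,i}>0$ for every $i$. The draws $\boldsymbol{\xi}_n=(\xi_{n,1},\dots,\xi_{n,k})^\top$, $n\ge1$, are random vectors with values in $\{e_1,\dots,e_k\}$. Set $\boldsymbol{B}_{n}=\beta\boldsymbol{B}_{n-1}+\alpha\boldsymbol{\xi}_{n}$ for $n\ge1$, and $\boldsymbol{N}_n=\boldsymbol{b}_0+\boldsymbol{B}_n$ for $n\ge0$. With $\mathcal{F}_0$ trivial and $\mathcal{F}_n=\sigma(\boldsymbol{\xi}_1,\dots,\boldsymbol{\xi}_n)$, the law of the draws is determined by $$P(\xi_{n+1,i}=1\mid\mathcal{F}_n)=\psi_{n,i},\qquad \boldsymbol{\psi}_n=\frac{\boldsymbol{N}_n}{|\boldsymbol{N}_n|}=\frac{\boldsymbol{b}_0+\boldsymbol{B}_n}{|\boldsymbol{b}_0|+|\boldsymbol{B}_n|},\qquad n\ge0.$$ Set $\overline{\boldsymbol{\xi}}_N=\frac1N\sum_{n=1}^N\boldsymbol{\xi}_n$. Stable convergence: on the underlying probability space $(\Omega,\mathcal{A},P)$, random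 vectors $Y_N$ in $\mathbb{R}^k$ converge stably to the Gaussian kernel $\mathcal{N}(\boldsymbol{0},\Sigma^2)$ (where $\Sigma^2=\Sigma^2(\omega)$ is a random positive semidefinite matrix) if for every bounded continuous $g:\mathbb{R}^k\to\mathbb{R}$ and every bounded $\mathcal{A}$-measurable real random variable $Z$, $E[Z\,g(Y_N)]\to E\big[Z\int g\,d\mathcal{N}(\boldsymbol{0},\Sigma^2)\big]$. Gaussian laws may be degenerate. *)

(* Defs.v *)
From HB Require Import structures.
From mathcomp Require Import all_boot all_order all_algebra.
From mathcomp Require Import all_classical all_reals all_analysis.
From mathcomp Require Import measurable_realfun.

Set Implicit Arguments.
Unset Strict Implicit.
Unset Printing Implicit Defensive.
Import Order.TTheory GRing.Theory Num.Theory.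
Import numFieldNormedType.Exports.
Local Open Scope classical_set_scope.
Local Open Scope ring_scope.

(* Vectors of R^k are columns 'cV[R]_k, with measurable structure generated by
   the k coordinates (the Borel sigma-algebra of the usual topology). *)
Definition colvec_display : measure_display. Proof. exact. Qed.

Definition coordinate {R : realType} {k : nat} (i : 'I_k) (x : 'cV[R]_k) : R :=
  x i 0.

Section colvec_measurable.
Context {R : realType} {k : nat}.
Implicit Types (A : set 'cV[R]_k) (F : (set 'cV[R]_k)^nat).
Let coord : 'I_k -> 'cV[R]_k -> R := coordinate.

Let colvec_set0 : g_sigma_preimage coord set0.
Proof. exact: sigma_algebra0. Qed.

Let colvec_setC A : g_sigma_preimage coord A -> g_sigma_preimage coord (~` A).
Proof. exact: sigma_algebraC. Qed.

Let colvec_bigcup F : (forall i, g_sigma_preimage coord (F i)) ->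
  g_sigma_preimage coord (\bigcup_i (F i)).
Proof. exact: sigma_algebra_bigcup. Qed.

HB.instance Definition _ := @isMeasurable.Build colvec_display 'cV[R]_k
  (g_sigma_preimage coord) colvec_set0 colvec_setC colvec_bigcup.

End colvec_measurable.

Lemma measurable_coordinate (R : realType) (k : nat) (i : 'I_k) :
  measurable_fun [set: 'cV[R]_k] (coordinate i).
Proof.
move=> _ Y mY; rewrite setTI; apply: sub_sigma_algebra => /=.
rewrite -bigcup_seq/=; exists i => /=; first by rewrite mem_index_enum.
by exists Y => //; rewrite setTI.
Qed.

Lemma measurable_colvecP d (T : measurableType d) (R : realType) (k : nat)
    (f : T -> 'cV[R]_k) :
  (forall i, measurable_fun [set: T] (fun w => f w i 0)) ->
  measurable_fun [set: T] f.
Proof.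
move=> mf; apply: (@measurability _ _ _ _ _ f
  (\big[setU/set0]_(i < k) preimage_set_system setT (@coordinate R k i)
     measurable)) => //.
move=> _ [B + <-]; rewrite -bigcup_seq => -[i _ [C mC <-]].
rewrite [X in _ `&` f @^-1` X]setTI -comp_preimage; exact: mf.
Qed.

Section gaussian_law.
Context {R : realType}.

Definition cons_col {k : nat} (p : measurableTypeR R * 'cV[R]_k) : 'cV[R]_k.+1 :=
  col_mx (p.1 : R)%:M p.2.

Let measurable_cons_col k : measurable_fun setT (@cons_col k).
Proof.
apply: measurable_colvecP => i; have [j|j] := @split_ordP 1 k i; move=> ->.
  rewrite (_ : (fun _ => _) = fst); first exact: measurable_fst.
  apply/funext => p.
  by rewrite /cons_col (col_mxEu (p.1%:M : 'M[R]_1)) ord1 mxE eqxx mulr1n.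
rewrite (_ : (fun _ => _) = coordinate j \o snd).
  apply: measurableT_comp; first exact: measurable_coordinate.
  exact: measurable_snd.
by apply/funext => p; rewrite /cons_col (col_mxEd (p.1%:M : 'M[R]_1)).
Qed.

HB.instance Definition _ k := isMeasurableFun.Build _ _ _ _ (@cons_col k)
  (@measurable_cons_col k).

(* N(0, I_k): k independent N(0, 1) coordinates. *)
Fixpoint std_gaussian (k : nat) : probability 'cV[R]_k R :=
  match k with
  | 0 => dirac (0 : 'cV[R]_0)
  | k'.+1 => distribution (normal_prob (0 : R) 1 \x std_gaussian k')%E
               (@cons_col k')
  end.

Let measurable_mulmx_col k (A : 'M[R]_k) :
  measurable_fun setT (mulmx A : 'cV[R]_k -> 'cV[R]_k).
Proof.
apply: measurable_colvecP => i.
rewrite (_ : (fun _ => _) = (fun x => \sum_j A i j * coordinate j x)); last first.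
  by apply/funext => x; rewrite mxE.
apply: measurable_sum => j; apply: measurable_funM => //.
exact: measurable_coordinate.
Qed.

HB.instance Definition _ k (A : 'M[R]_k) :=
  isMeasurableFun.Build _ _ _ _ (mulmx A : 'cV[R]_k -> 'cV[R]_k)
    (@measurable_mulmx_col k A).

(* Some A with A A^T = S; it exists when S is symmetric positive semidefinite
   (0 is a junk value otherwise). *)
Definition mx_root (k : nat) (S : 'M[R]_k) : 'M[R]_k :=
  xget 0 [set A | A *m A^T = S].

(* N(0, S), possibly degenerate: the law of A Z with A A^T = S and Z a standard
   Gaussian vector; it does not depend on the choice of A. *)
Definition gaussian (k : nat) (S : 'M[R]_k) : probability 'cV[R]_k R :=
  distribution (std_gaussian k) (mulmx (mx_root S) : 'cV[R]_k -> 'cV[R]_k).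

End gaussian_law.

Section stable_convergence.
Context d (T : measurableType d) (R : realType) (P : probability T R).
Context (k : nat).

(* Stable convergence of Y_N to the Gaussian kernel w |-> N(0, S w). *)
Definition stable_cvg_gaussian (Y : nat -> T -> 'cV[R]_k) (S : T -> 'M[R]_k) :=
  forall (g : 'cV[R]_k -> R) (Z : {RV P >-> R}),
    continuous g -> [bounded g x | x in setT] ->
    [bounded Z w | w in setT] ->
    ('E_P[(fun w => Z w * g (Y N w))%R])%E @[N --> \oo] -->
    ('E_P[(fun w => Z w * \int[gaussian (S w)]_x g x)%R])%E.

(* p is a version of the conditional probability P(E | G). *)
Definition is_cond_probability (G : set (set T)) (E : set T) (p : T -> R) :=
  [/\ forall B : set R, measurable B -> G (p @^-1` B),
      P.-integrable setT (EFin \o p) &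
      forall A, G A -> (\int[P]_(w in A) (p w)%:E)%E = P (A `&` E)].

End stable_convergence.

Definition l1norm {R : realType} {k : nat} (x : 'cV[R]_k) : R :=
  \sum_i `|x i 0|.

Definition canonical_basis {R : realType} {k : nat} (i : 'I_k) : 'cV[R]_k :=
  delta_mx i 0.

(* The draws are xi 1, xi 2, ...; xi 0 plays no role. *)
Section rescaled_polya_urn.
Context d (T : measurableType d) (R : realType) (P : probability T R).
Context (k : nat) (alpha beta : R) (b0 B0 : 'cV[R]_k).
Variable xi : nat -> {RV P >-> 'cV[R]_k}.

Fixpoint urn_B (n : nat) (w : T) : 'cV[R]_k :=
  match n with
  | 0 => B0
  | m.+1 => beta *: urn_B m w + alpha *: xi m.+1 w
  end.

Definition urn_N (n : nat) (w : T) : 'cV[R]_k := b0 + urn_B n w.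

Definition urn_psi (n : nat) (w : T) : 'cV[R]_k :=
  (l1norm (urn_N n w))^-1 *: urn_N n w.

(* F_n = sigma(xi_1, ..., xi_n) *)
Definition urn_filtration (n : nat) : set (set T) :=
  g_sigma_preimage (fun m : 'I_n => xi m.+1 : T -> 'cV[R]_k).

Definition rescaled_polya_urn : Prop :=
  [/\ forall i, 0 <= b0 i 0 /\ 0 <= B0 i 0,
      0 < l1norm b0,
      forall i, 0 < b0 i 0 + B0 i 0,
      forall n w, exists i, xi n.+1 w = canonical_basis i &
      forall n i, is_cond_probability P (urn_filtration n)
        [set w | xi n.+1 w i 0 = 1] (fun w => urn_psi n w i 0)].

Definition xi_mean (N : nat) (w : T) : 'cV[R]_k :=
  N%:R^-1 *: \sum_(1 <= n < N.+1) xi n w.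

Definition psi_infty (w : T) : 'cV[R]_k :=
  (l1norm B0 + alpha / (beta - 1))^-1 *:
  (B0 + alpha *: \big[+%R/0]_(1 <= n <oo) (beta ^- n *: xi n w)).

Definition Sigma2 (w : T) : 'M[R]_k :=
  diag_mx (psi_infty w)^T - psi_infty w *m (psi_infty w)^T.

End rescaled_polya_urn.

(* Main.v *)
Require Import Defs.
From mathcomp Require Import all_boot all_order all_algebra.
From mathcomp Require Import all_classical all_reals all_analysis.
From mathcomp Require Import measurable_realfun ring lra.
Import Order.TTheory GRing.Theory Num.Theory.
Import numFieldNormedType.Exports.
Set Implicit Arguments.
Unset Strict Implicit.
Unset Printing Implicit Defensive.
Local Open Scope classical_set_scope.
Local Open Scope ring_scope.

(** Because beta > 1 the composition of the urn freezes: divided by beta ^ n it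
    differs from its limit by O (beta ^ -n), with a constant that does not depend
    on the draws ([urn_psi_rate]).  Hence the sum over all j of psi j - psi_infty
    is bounded, and up to O (N ^ (-1/2)), uniformly, both normalized differences
    of the theorem equal S_N / sqrt N, where S_N is the sum over j < N of
    xi (j + 1) - psi j ([drift_bound]).  The increments of S are bounded and
    centred given the past.  The fourth moment of S_N is therefore O (N^2), the
    expectations of (S_N / N)^4 are summable, and S_N / N tends to 0 almost surely
    ([walk_average_cvg0]); this is the law of large numbers.

    For the central limit theorem fix a direction u.  Given the past, a step of
    u.S has variance quad u (psi n), which also moves by O (beta ^ -n) only.  Let
    phi be bounded and depend on the first m draws.  The variable
    phi * cos (u.S_n / sqrt N + th) * exp (- (N - n) / (2 N) * quad u (psi n))
    passes from n = m to n = N at the cost, in expectation, of O (N ^ (-3/2))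
    per step, by a Taylor expansion, plus the sum of the O (beta ^ -n) over n >= m
    ([interpolation_telescope]).  Since m may be enlarged, phi is asymptotically
    orthogonal to
      H_N = cos (u.S_N / sqrt N + th) - exp (- quad u psi_infty / 2) * cos th
    ([history_deviation_cvg]).  Stable convergence asks for this with an arbitrary
    bounded variable Z instead of phi.  But each H_j is a uniform limit of such
    phi, so the bounded sequence H is asymptotically orthogonal to each of its own
    members, and this alone makes it tend weakly to 0
    ([weak_cvg0_of_orthogonal]).

    The second term of H_N is the mean of cos (u.x + th) under the normal law with
    covariance Sigma2 ([gaussian_cos]).  The passage from cosines to a bounded
    continuous g is a continuity theorem ([stable_cvg_of_cos]).  It approximates g
    on large cubes by trigonometric polynomials that obey the same global bound
    ([trig_approx]) and controls the rest by tightness, which on the Gaussian side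
    is uniform over all covariance matrices involved ([gaussian_tight]). *)

(** * Expectations of bounded measurable functions *)

Definition bmeas d (T : measurableType d) (R : realType) (f : T -> R) : Prop :=
  measurable_fun [set: T] f /\ exists C, forall x, `|f x| <= C.

Section bounded_measurable.
Context d (T : measurableType d) (R : realType).
Implicit Types f g : T -> R.

Lemma bmeas_cst (c : R) : bmeas (fun _ : T => c).
Proof. by split; [exact: measurable_cst|exists `|c|]. Qed.

Lemma bmeasD f g : bmeas f -> bmeas g -> bmeas (fun x => f x + g x).
Proof.
move=> [mf [C fC]] [mg [D gD]]; split; first exact: measurable_funD.
by exists (C + D) => x; apply: le_trans (ler_normD _ _) _; exact: lerD.
Qed.

Lemma bmeasM f g : bmeas f -> bmeas g -> bmeas (fun x => f x * g x).
Proof.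
move=> [mf [C fC]] [mg [D gD]]; split; first exact: measurable_funM.
by exists (C * D) => x; rewrite normrM; exact: ler_pM.
Qed.

Lemma bmeasZ c f : bmeas f -> bmeas (fun x => c * f x).
Proof. by move=> bf; apply: bmeasM => //; exact: bmeas_cst. Qed.

Lemma bmeasN f : bmeas f -> bmeas (fun x => - f x).
Proof.
move=> [mf [C fC]]; split; last by exists C => x; rewrite normrN.
exact: measurableT_comp.
Qed.

Lemma bmeasB f g : bmeas f -> bmeas g -> bmeas (fun x => f x - g x).
Proof. by move=> bf bg; apply: bmeasD => //; exact: bmeasN. Qed.

Lemma bmeasX f n : bmeas f -> bmeas (fun x => f x ^+ n).
Proof.
move=> bf; elim: n => [|n IH]; first exact: bmeas_cst.
rewrite (_ : (fun x => _) = (fun x => f x * f x ^+ n)); first exact: bmeasM.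
by apply/funext => x; rewrite exprS.
Qed.

Lemma bmeas_norm f : bmeas f -> bmeas (fun x => `|f x|).
Proof.
move=> [mf [C fC]]; split; first exact: measurableT_comp.
by exists C => x; rewrite normr_id.
Qed.

Lemma bmeas_sum (I : Type) (s : seq I) (h : I -> T -> R) :
  (forall i, bmeas (h i)) -> bmeas (fun x => \sum_(i <- s) h i x).
Proof.
move=> bh; elim: s => [|i s IH].
  by under eq_fun do rewrite big_nil; exact: bmeas_cst.
by under eq_fun do rewrite big_cons; exact: bmeasD.
Qed.

Lemma bmeas_cos f : measurable_fun setT f -> bmeas (fun x => cos (f x)).
Proof.
move=> mf; split; last by exists 1 => x; exact: cos_max.
apply: measurableT_comp => //; apply: continuous_measurable_fun.
exact: continuous_cos.
Qed.

Lemma bmeas_le f (C : R) : measurable_fun setT f -> (forall x, `|f x| <= C) ->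
  bmeas f.
Proof. by move=> mf fC; split => //; exists C. Qed.

End bounded_measurable.

Ltac solve_bmeas := repeat first
  [ eassumption | match goal with h : forall _, bmeas _ |- _ => exact: h end
  | exact: bmeas_cst | apply: bmeas_norm | apply: bmeasN | apply: bmeasD
  | apply: bmeasX | apply: bmeasM | apply: bmeas_sum => ? ].

Section expectation.
Context d (T : measurableType d) (R : realType) (m : probability T R).
Implicit Types f g : T -> R.


Lemma bmeas_integrable f : bmeas f -> m.-integrable setT (EFin \o f).
Proof.
move=> [mf [C fC]].
apply: (@le_integrable _ _ _ _ _ _ _ (cst C%:E)) => //.
- exact/measurable_EFinP.
- by move=> x _ /=; rewrite lee_fin (le_trans (fC x))// ler_norm.
- apply/integrableP; split => //.
  rewrite (eq_integral (cst `|C|%:E)) //= integral_cst//= probability_setT mule1.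
  by rewrite ltry.
Qed.

Lemma ExD f g : bmeas f -> bmeas g ->
  \int[m]_x (f x + g x) = \int[m]_x f x + \int[m]_x g x.
Proof. by move=> bf bg; rewrite RintegralD//; exact: bmeas_integrable. Qed.

Lemma ExB f g : bmeas f -> bmeas g ->
  \int[m]_x (f x - g x) = \int[m]_x f x - \int[m]_x g x.
Proof. by move=> bf bg; rewrite RintegralB//; exact: bmeas_integrable. Qed.

Lemma ExZ c f : bmeas f -> \int[m]_x (c * f x) = c * \int[m]_x f x.
Proof. by move=> bf; rewrite RintegralZl//; exact: bmeas_integrable. Qed.

Lemma Ex_cst c : \int[m]_x (c : R) = c.
Proof. by rewrite Rintegral_cst//= probability_setT mulr1. Qed.

Lemma Ex_sum (I : Type) (s : seq I) (h : I -> T -> R) :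
  (forall i, bmeas (h i)) ->
  \int[m]_x (\sum_(i <- s) h i x) = \sum_(i <- s) \int[m]_x h i x.
Proof.
move=> bh; elim: s => [|i s IH].
  by under eq_Rintegral do rewrite big_nil; rewrite Ex_cst big_nil.
under eq_Rintegral do rewrite big_cons.
by rewrite ExD// ?big_cons ?IH//; exact: bmeas_sum.
Qed.

Lemma Ex_le f g : bmeas f -> bmeas g -> (forall x, f x <= g x) ->
  \int[m]_x f x <= \int[m]_x g x.
Proof. by move=> bf bg fg; apply: le_Rintegral => //; exact: bmeas_integrable. Qed.

Lemma Ex_norm_le f g : bmeas f -> bmeas g -> (forall x, `|f x| <= g x) ->
  `|\int[m]_x f x| <= \int[m]_x g x.
Proof.
move=> bf bg fg; apply: (@le_trans _ _ (\int[m]_x `|f x|)).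
  by apply: le_normr_Rintegral => //; exact: bmeas_integrable.
by apply: Ex_le => //; exact: bmeas_norm.
Qed.

Lemma Ex_norm_le_cst f C : bmeas f -> (forall x, `|f x| <= C) ->
  `|\int[m]_x f x| <= C.
Proof.
move=> bf fC; rewrite -[leRHS](Ex_cst C); apply: Ex_norm_le => //.
exact: bmeas_cst.
Qed.

Lemma Ex_dist f g C : bmeas f -> bmeas g -> (forall x, `|f x - g x| <= C) ->
  `|\int[m]_x f x - \int[m]_x g x| <= C.
Proof.
by move=> bf bg fgC; rewrite -ExB//; apply: Ex_norm_le_cst => //; exact: bmeasB.
Qed.

End expectation.
(** * Weak convergence from asymptotic orthogonality *)

Lemma cvg0P (R : realType) (u : nat -> R) :
  u n @[n --> \oo] --> 0 <->
  forall e, 0 < e -> exists N, forall n, (N <= n)%N -> `|u n| <= e.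
Proof.
split.
- move=> /cvgr0Pnorm_le u0 e e0; have [N _ uN] := u0 e e0.
  by exists N => n Nn; exact: uN.
- move=> u0; apply/cvgr0Pnorm_le => e e0; have [N uN] := u0 e e0.
  by exists N.
Qed.

Section asymptotically_orthogonal.
Context d (T : measurableType d) (R : realType) (m : probability T R).
Variables (H : nat -> T -> R) (C : R).
Hypothesis mH : forall n, measurable_fun setT (H n).
Hypothesis HC : forall n x, `|H n x| <= C.
Hypothesis H0 : forall k, \int[m]_x (H k x * H n x) @[n --> \oo] --> 0.

Let bH n : bmeas (H n). Proof. by split => //; exists C. Qed.

(** If the pairings with Z did not vanish, then infinitely many of the signed
    variables would each pair with Z at least to the amount eps; picking them
    far enough apart makes them almost orthogonal, so that the second moment
    of a sum of J of them grows only linearly in J. *)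
Lemma almost_orthogonal_sums (Z : T -> R) (eps : R) : bmeas Z ->
  (forall N, exists2 n, (N <= n)%N & eps < `|\int[m]_x (Z x * H n x)|) ->
  forall J : nat, exists V : T -> R,
    [/\ bmeas V, \int[m]_x (V x * H n x) @[n --> \oo] --> 0,
        J%:R * eps <= \int[m]_x (Z x * V x) &
        \int[m]_x (V x ^+ 2) <= J%:R * (C ^+ 2 + 1)].
Proof.
move=> bZ far; elim=> [|J [V [bV V0 ZV V2]]].
  exists (fun=> 0); split; first exact: bmeas_cst.
  - under eq_fun do (under eq_Rintegral do rewrite mul0r).
    under eq_fun do rewrite Ex_cst; exact: cvg_cst.
  - by under eq_Rintegral do rewrite mulr0; rewrite Ex_cst mul0r.
  - by under eq_Rintegral do rewrite expr0n/=; rewrite Ex_cst mul0r.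
have [N VN] := (cvg0P _).1 V0 2^-1 ltac:(by rewrite invr_gt0).
have [n Nn Zn] := far N.
pose s : R := Num.sg (\int[m]_x (Z x * H n x)).
have sZ : s * \int[m]_x (Z x * H n x) = `|\int[m]_x (Z x * H n x)|.
  by rewrite [RHS]normrEsg.
have s1 : `|s| <= 1.
  by rewrite /s normr_sg lern1; case: (_ == _).
exists (fun x => V x + s * H n x); split.
- by apply: bmeasD => //; exact: bmeasZ.
- have -> : (fun k => \int[m]_x ((V x + s * H n x) * H k x)) =
    (fun k => \int[m]_x (V x * H k x) + s * \int[m]_x (H n x * H k x)).
    apply/funext => k; rewrite -ExZ ?[RHS]esym; last exact: bmeasM.
    rewrite -ExD; [|exact: bmeasM|by apply: bmeasZ; exact: bmeasM].
    by apply: eq_Rintegral => x _; ring.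
  rewrite -[X in _ --> X](addr0 0) -[X in _ + X](mulr0 s).
  by apply: cvgD => //; apply: cvgM => //; exact: cvg_cst.
- have -> : \int[m]_x (Z x * (V x + s * H n x)) =
    \int[m]_x (Z x * V x) + s * \int[m]_x (Z x * H n x).
    rewrite -ExZ; last exact: bmeasM.
    rewrite -ExD; [|exact: bmeasM|by apply: bmeasZ; exact: bmeasM].
    by apply: eq_Rintegral => x _; ring.
  by rewrite sZ -natr1 mulrDl mul1r lerD// ltW.
- have -> : \int[m]_x ((V x + s * H n x) ^+ 2) =
    \int[m]_x (V x ^+ 2) + 2 * s * \int[m]_x (V x * H n x)
     + s ^+ 2 * \int[m]_x (H n x ^+ 2).
    rewrite -!ExZ -?ExD; try by solve_bmeas.
    by apply: eq_Rintegral => x _; ring.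
  have -> : J.+1%:R * (C ^+ 2 + 1) = J%:R * (C ^+ 2 + 1) + (1 + C ^+ 2).
    by rewrite -natr1; ring.
  rewrite -addrA lerD// lerD//; last first.
    have HC2 : \int[m]_x (H n x ^+ 2) <= C ^+ 2.
      rewrite -[leRHS](Ex_cst m); apply: Ex_le; [exact: bmeasX|exact: bmeas_cst|].
      move=> x; rewrite -real_normK ?num_real// lerXn2r ?nnegrE//.
      exact: le_trans (HC n x).
    have HH0 : 0 <= \int[m]_x (H n x ^+ 2).
      by apply: Rintegral_ge0 => x _; exact: sqr_ge0.
    have s2 : s ^+ 2 <= 1 by rewrite -real_normK ?num_real// expr_le1.
    by apply: le_trans HC2; rewrite ler_piMl.
  apply: le_trans (ler_norm _) _; rewrite -mulrA normrM (ger0_norm (ler0n _ _)).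
  rewrite normrM -ler_pdivlMl// mulr1 -[leRHS]mul1r.
  by apply: ler_pM => //; exact: VN.
Qed.

(** A bounded sequence whose members become orthogonal to each fixed member
    tends weakly to 0: this is how an estimate against variables that depend on
    finitely many draws is upgraded to an arbitrary bounded test variable, as
    stable convergence demands.  Otherwise the sums V of the preceding lemma
    contradict the Cauchy-Schwarz inequality, here in the form
    2 Z V <= t Z^2 + V^2 / t. *)
Lemma weak_cvg0_of_orthogonal (Z : T -> R) : bmeas Z ->
  \int[m]_x (Z x * H n x) @[n --> \oo] --> 0.
Proof.
move=> bZ; apply/cvg0P => e e0; apply: contrapT => nN.
have far N : exists2 n, (N <= n)%N & e < `|\int[m]_x (Z x * H n x)|.
  apply: contrapT => far; apply: nN; exists N => n Nn.
  by rewrite leNgt; apply/negP => en; apply: far; exists n.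
set D := \int[m]_x (Z x ^+ 2).
have D0 : 0 <= D by apply: Rintegral_ge0 => x _; exact: sqr_ge0.
have c0 : 0 < C ^+ 2 + 1 by rewrite ltr_wpDl// sqr_ge0.
have young (s a b : R) : 0 < s -> 2 * (a * b) <= s * a ^+ 2 + s^-1 * b ^+ 2.
  move=> s0; have -> : s * a ^+ 2 + s^-1 * b ^+ 2 =
      s^-1 * (s * a - b) ^+ 2 + 2 * (a * b) by field; rewrite gt_eqF.
  by rewrite lerDr mulr_ge0 ?sqr_ge0// invr_ge0 ltW.
pose t := (C ^+ 2 + 1) / e.
have t0 : 0 < t by rewrite divr_gt0.
have bnd J : J%:R * e <= t * D.
  have [V [bV _ ZV V2]] := almost_orthogonal_sums bZ far J.
  have : \int[m]_x (2 * (Z x * V x)) <=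
         \int[m]_x (t * Z x ^+ 2 + t^-1 * V x ^+ 2).
    apply: Ex_le.
    - by apply: bmeasZ; exact: bmeasM.
    - by apply: bmeasD; apply: bmeasZ; exact: bmeasX.
    - by move=> x; exact: young.
  rewrite ExD; [|by apply: bmeasZ; exact: bmeasX..].
  rewrite !ExZ; [|exact: bmeasX|exact: bmeasX|exact: bmeasM].
  rewrite -/D => le2.
  have le3 : t^-1 * \int[m]_x (V x ^+ 2) <= J%:R * e.
    rewrite ler_pdivrMl//.
    suff -> : t * (J%:R * e) = J%:R * (C ^+ 2 + 1) by [].
    by rewrite /t; field; rewrite gt_eqF.
  have : 2 * (J%:R * e) <= t * D + J%:R * e.
    by apply: (le_trans _ (le_trans le2 _)); [rewrite ler_pM2l|rewrite lerD2l].
  by rewrite mulr_natl mulr2n lerD2r.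
have [J] : exists J : nat, t * D / e < J%:R.
  exists (Num.truncn (t * D / e)).+1; exact: truncnS_gt.
by rewrite ltr_pdivrMr// ltNge bnd.
Qed.

End asymptotically_orthogonal.
(** * Approximation by trigonometric polynomials *)

Definition dot (R : realType) (k : nat) (u x : 'cV[R]_k) : R :=
  \sum_i u i 0 * x i 0.

Section dot_product.
Context (R : realType) (k : nat).
Implicit Types u v x y : 'cV[R]_k.

Lemma dotDl u v x : dot (u + v) x = dot u x + dot v x.
Proof. by rewrite /dot -big_split; apply: eq_bigr => i _; rewrite mxE mulrDl. Qed.

Lemma dotNl u x : dot (- u) x = - dot u x.
Proof. by rewrite /dot -sumrN; apply: eq_bigr => i _; rewrite mxE mulNr. Qed.

Lemma dot0l x : dot 0 x = 0.
Proof. by rewrite /dot big1// => i _; rewrite mxE mul0r. Qed.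

Lemma dotDr u x y : dot u (x + y) = dot u x + dot u y.
Proof. by rewrite /dot -big_split; apply: eq_bigr => i _; rewrite mxE mulrDr. Qed.

Lemma dotNr u x : dot u (- x) = - dot u x.
Proof. by rewrite /dot -sumrN; apply: eq_bigr => i _; rewrite mxE mulrN. Qed.

Lemma dotBr u x y : dot u (x - y) = dot u x - dot u y.
Proof. by rewrite dotDr dotNr. Qed.

Lemma dotZr u c x : dot u (c *: x) = c * dot u x.
Proof. by rewrite /dot mulr_sumr; apply: eq_bigr => i _; rewrite mxE; ring. Qed.

Lemma dotZl u c x : dot (c *: u) x = c * dot u x.
Proof. by rewrite /dot mulr_sumr; apply: eq_bigr => i _; rewrite mxE mulrA. Qed.

Lemma dot_delta i x : dot (delta_mx i 0) x = x i 0.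
Proof.
rewrite /dot (bigD1 i)//= big1 ?addr0 ?mxE ?eqxx ?mul1r// => j ji.
by rewrite mxE (negbTE ji) mul0r.
Qed.

Lemma measurable_dot u : measurable_fun setT (dot u).
Proof.
apply: measurable_sum => i; apply: measurable_funM => //.
exact: measurable_coordinate.
Qed.

End dot_product.

(** Products of cosines are again sums of cosines, so that this linear span is
    an algebra; it is nevertheless small enough for convergence of expectations
    to be checked on one cosine at a time. *)
Inductive trig (R : realType) (k : nat) : ('cV[R]_k -> R) -> Prop :=
| trig_cos u th : trig (fun x => cos (dot u x + th))
| trig_add f g : trig f -> trig g -> trig (fun x => f x + g x)
| trig_scale c f : trig f -> trig (fun x => c * f x).

Section trigonometric_polynomials.
Context (R : realType) (k : nat).
Implicit Types (f g : 'cV[R]_k -> R) (s : 'I_k -> R).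

Lemma trig_cst (c : R) : trig (fun _ : 'cV[R]_k => c).
Proof.
rewrite (_ : (fun _ => _) = (fun x : 'cV[R]_k => c * cos (dot 0 x + 0))).
  exact/trig_scale/trig_cos.
by apply/funext => x; rewrite dot0l addr0 cos0 mulr1.
Qed.

Lemma trig_mul f g : trig f -> trig g -> trig (fun x => f x * g x).
Proof.
move=> tf; elim: tf g => [u a|f1 f2 _ IH1 _ IH2|c f1 _ IH] g tg.
- elim: tg => [v b|g1 g2 _ IH1 _ IH2|c g1 _ IH].
  + rewrite (_ : (fun x => _) = fun x : 'cV[R]_k =>
      2^-1 * cos (dot (u + v) x + (a + b)) + 2^-1 * cos (dot (u - v) x + (a - b))).
      by apply: trig_add; apply/trig_scale/trig_cos.
    apply/funext => x; rewrite !dotDl dotNl.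
    have -> : dot u x + dot v x + (a + b) = dot u x + a + (dot v x + b) by ring.
    have -> : dot u x - dot v x + (a - b) = dot u x + a - (dot v x + b) by ring.
    by move: (dot u x + a) (dot v x + b) => A B; rewrite cosD cosB; field.
  + under eq_fun do rewrite mulrDr; exact: trig_add.
  + under eq_fun do rewrite mulrCA; exact: trig_scale.
- by under eq_fun do rewrite mulrDl; apply: trig_add; [exact: IH1|exact: IH2].
- by under eq_fun do rewrite -mulrA; apply: trig_scale; exact: IH.
Qed.

Lemma trig_sin (c : R) (i : 'I_k) : trig (fun x : 'cV[R]_k => sin (c * x i 0)).
Proof.
rewrite (_ : (fun x => _) =
  (fun x => cos (dot (c *: delta_mx i 0) x + - (pi / 2)))); first exact: trig_cos.
by apply/funext => x; rewrite dotZl dot_delta cosBpihalf.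
Qed.

Lemma trig_bmeas f : trig f -> bmeas f.
Proof.
elim=> [u th|f1 f2 _ b1 _ b2|c f1 _ b1].
- by apply: bmeas_cos; apply: measurable_funD => //; exact: measurable_dot.
- exact: bmeasD.
- exact: bmeasZ.
Qed.

Definition bump (i : 'I_k) (v : 'I_k -> nat) : 'I_k -> nat :=
  fun j => ((j == i) + v j)%N.

(** The mean of F at the endpoint of a walk from v: each entry i of l stands for
    a step that moves coordinate i up by one with probability s i.  When every
    coordinate occurs n times in l this is the multivariate Bernstein polynomial
    of degree n in s. *)
Fixpoint bernstein s (l : seq 'I_k) (F : ('I_k -> nat) -> R) v : R :=
  match l with
  | [::] => F v
  | i :: l' => s i * bernstein s l' F (bump i v) + (1 - s i) * bernstein s l' F v
  end.

(** The right-hand side is the mean of a + b * sum_i (w i - p i)^2 over the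
    endpoint w of the walk: squared bias plus variance in each coordinate. *)
Lemma bernstein_dist s (l : seq 'I_k) (F : ('I_k -> nat) -> R) v c (a b : R)
    (p : 'I_k -> R) :
  (forall i, 0 <= s i <= 1) -> 0 <= b ->
  (forall w, `|F w - c| <= a + b * \sum_i ((w i)%:R - p i) ^+ 2) ->
  `|bernstein s l F v - c| <= a + b * \sum_i
    (((v i)%:R + (count_mem i l)%:R * s i - p i) ^+ 2
     + (count_mem i l)%:R * (s i * (1 - s i))).
Proof.
move=> s01 b0 fc; elim: l v => [|i l IH] v /=.
  apply: le_trans (fc v) _; rewrite lerD2l ler_wpM2l// ler_sum// => i _.
  by rewrite !mul0r !addr0.
have /andP[si0 si1] := s01 i.
have -> : s i * bernstein s l F (bump i v) + (1 - s i) * bernstein s l F v - c =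
  s i * (bernstein s l F (bump i v) - c) + (1 - s i) * (bernstein s l F v - c).
  by ring.
apply: le_trans (ler_normD _ _) _; rewrite !normrM (ger0_norm si0).
rewrite (@ger0_norm _ (1 - s i)) ?subr_ge0//.
apply: (le_trans (lerD (ler_wpM2l si0 (IH (bump i v)))
  (ler_wpM2l _ (IH v)))); first by rewrite subr_ge0.
set A := \sum_i0 _; set B := \sum_i0 _; set D := \sum_i0 _.
rewrite (_ : D = s i * A + (1 - s i) * B).
  by rewrite le_eqVlt; apply/orP; left; apply/eqP; ring.
rewrite /A /B /D !mulr_sumr -big_split; apply: eq_bigr => j _ /=.
rewrite /bump eq_sym; have [->|ji] := eqVneq i j; last by rewrite !add0n; ring.
rewrite !natrD /=; ring.
Qed.

Lemma bernstein_trig (s : 'I_k -> 'cV[R]_k -> R) (l : seq 'I_k)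
    (F : ('I_k -> nat) -> R) v :
  (forall i, trig (s i)) -> trig (fun x => bernstein (s^~ x) l F v).
Proof.
move=> ts; elim: l v => [|i l IH] v /=; first exact: trig_cst.
apply: trig_add; apply: trig_mul => //.
apply: trig_add; first exact: trig_cst.
by under eq_fun do rewrite -mulN1r; exact: trig_scale.
Qed.

Lemma continuous_cube_uniform g (L e : R) : continuous g -> 0 < e ->
  exists2 del, 0 < del & forall x y : 'cV[R]_k, (forall i, `|x i 0| <= L) ->
    (forall i, `|y i 0 - x i 0| <= del) -> `|g y - g x| <= e.
Proof.
move=> cg e0.
pose K := [set v : 'rV[R]_k | forall i, `[- L, L]%classic (v ord0 i)].
have cK : compact K.
  by apply: (@rV_compact R k (fun=> `[- L, L]%classic)) => i; exact: segment_compact.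
have := (compact_near_coveringP K).1 cK _ (0^'+ : set_system R)
  (fun del x => forall y : 'cV[R]_k, (forall i, `|y i 0 - x 0 i| <= del) ->
     `|g y - g x^T| <= e) _.
move=> /(_ _)[].
  move=> x Kx.
  have /cvgrPdist_lt/(_ (e / 2)) := cg x^T.
  rewrite divr_gt0// => /(_ isT)/nbhs_ballP[r /= r0 rg].
  exists (ball x (r / 2), [set t | t < r / 2]).
    split => /=; first by apply: nbhsx_ballx; rewrite divr_gt0.
    by apply: nbhs_right_lt; rewrite divr_gt0.
  move=> [x' del] /= [[_ xx'] delr] y yx'.
  have r2 : 0 < r / 2 by rewrite divr_gt0.
  have gx' : `|g x^T - g x'^T| < e / 2.
    apply: rg; split => // i j; rewrite !mxE.
    by apply: le_ball (xx' j i); rewrite ler_pdivrMr// ler_peMr ?ler1n// ltW.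
  have gy : `|g x^T - g y| < e / 2.
    apply: rg; split => // i j; rewrite !mxE (ord1 j) /ball/=.
    have := xx' 0 i; rewrite /ball/= => h1.
    rewrite (_ : _ - _ = (x 0 i - x' 0 i) + - (y i 0 - x' 0 i)); last by ring.
    apply: le_lt_trans (ler_normD _ _) _; rewrite normrN.
    by rewrite (splitr r) ltrD// (le_lt_trans (yx' i)).
  rewrite (_ : _ - _ = (g x^T - g x'^T) - (g x^T - g y)); last by ring.
  by apply: le_trans (ler_normB _ _) _; rewrite (splitr e) lerD// ltW.
move=> del /= del0 H; exists (del / 2); first by rewrite divr_gt0.
move=> x y xL xy.
have := H (del / 2) _ _ x^T _ y; rewrite trmxK; apply.
- by rewrite /ball/= sub0r normrN gtr0_norm ?divr_gt0// ltr_pdivrMr// ltr_pMr// ltr1n.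
- by rewrite divr_gt0.
- by move=> i; rewrite mxE /= in_itv/= -ler_norml.
- by move=> i; rewrite mxE.
Qed.

(** By sin a - sin b = 2 sin ((a - b) / 2) cos ((a + b) / 2).  This is a modulus
    of continuity for the inverse sine that is valid up to the endpoints. *)
Lemma sin_gap (a b h : R) : - (pi / 2) <= a <= pi / 2 -> - (pi / 2) <= b <= pi / 2 ->
  0 <= h <= `|a - b| -> 2 * sin (h / 2) ^+ 2 <= `|sin a - sin b|.
Proof.
wlog ba : a b / b <= a => [W aI bI hab|].
  have [ba|/ltW ab] := leP b a; first exact: W.
  by rewrite distrC; apply: W => //; rewrite distrC.
move=> /andP[a1 a2] /andP[b1 b2] /andP[h0]; rewrite ger0_norm ?subr_ge0// => hab.
pose t := (a - b) / 2; pose m := (a + b) / 2.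
have t2 : t <= pi / 2 by rewrite /t; lra.
have ht : h / 2 <= t by rewrite /t; lra.
have -> : sin a - sin b = 2 * (sin t * cos m).
  have -> : a = m + t by rewrite /m /t; field.
  have -> : b = m - t by rewrite /m /t; field.
  by rewrite sinD sinB; ring.
have sin_mono (x y : R) : 0 <= x -> x <= y -> y <= pi / 2 -> sin x <= sin y.
  move=> x0 xy y2; rewrite leNgt ltr_sin ?in_itv/= -?leNgt//; apply/andP; split; lra.
have sh : 0 <= sin (h / 2).
  by apply: sin_ge0_pi; apply/andP; split; have := @pi_gt0 R; lra.
have st : sin (h / 2) <= sin t by apply: sin_mono => //; rewrite divr_ge0.
(* m is at distance at least t from the endpoints of [-pi/2, pi/2] *)
have cm : sin t <= cos m.
  have cos_anti (x y : R) : 0 <= x -> x <= y -> y <= pi -> cos y <= cos x.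
    move=> x0 xy ypi; rewrite leNgt ltr_cos ?in_itv/= -?leNgt//; apply/andP; split; lra.
  rewrite -(cos_norm m) -cosBpihalf -cosN; apply: cos_anti => //.
    rewrite ler_norml /m /t; apply/andP; split; lra.
  by rewrite /t; have := @pi_gt0 R; lra.
have st0 : 0 <= sin t := le_trans sh st.
rewrite ger0_norm ?mulr_ge0// ?(le_trans st0 cm)// ler_pM2l// expr2.
by apply: ler_pM => //; exact: le_trans cm.
Qed.

(** Put c = pi / (2 L).  The substitution s = (1 + sin (c x)) / 2 maps the
    interval from -L to L bijectively onto the unit interval, so that a Bernstein
    polynomial in s is a trigonometric polynomial in x.  Its values are averages
    of values of g; hence the bound C holds everywhere and not only on the cube,
    which is what an ordinary polynomial approximation could not provide. *)
Lemma trig_approx g (C L e : R) : continuous g -> (forall x, `|g x| <= C) ->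
  0 < L -> 0 < e -> exists t : 'cV[R]_k -> R, [/\ trig t, forall x, `|t x| <= C &
    forall x : 'cV[R]_k, (forall i, `|x i 0| <= L) -> `|t x - g x| <= e].
Proof.
move=> cg gC L0 e0.
have C0 : 0 <= C := le_trans (normr_ge0 _) (gC 0).
have pi0 := @pi_gt0 R.
pose c := pi / 2 / L.
have c0 : 0 < c by rewrite !divr_gt0.
have e20 : 0 < e / 2 by rewrite divr_gt0.
have [del del0 gdel] := continuous_cube_uniform L cg e20.
pose h := Num.min (c * del) (pi / 2).
have h0 : 0 < h by rewrite lt_min mulr_gt0// divr_gt0.
have hpi : h <= pi / 2 by rewrite ge_min lexx orbT.
pose eta := sin (h / 2) ^+ 2.
have eta0 : 0 < eta.
  by rewrite exprn_gt0// sin_gt0_pi//; apply/andP; split; lra.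
pose n := (Num.truncn (C * k%:R / (eta ^+ 2 * e))).+1.
have nn : C * k%:R / (eta ^+ 2 * e) < n%:R := truncnS_gt _.
have n0 : 0 < n%:R :> R by rewrite ltr0n.
pose y (m : nat) : R := 2 * (m%:R / n%:R) - 1.
have y1 m : (m <= n)%N -> -1 <= y m <= 1.
  move=> mn; have m0 : 0 <= m%:R / n%:R :> R by rewrite divr_ge0.
  have m1 : m%:R / n%:R <= 1 :> R by rewrite ler_pdivrMr// mul1r ler_nat.
  by apply/andP; split; rewrite /y; lra.
pose node (v : 'I_k -> nat) : 'cV[R]_k := \col_i (asin (y (minn (v i) n)) / c).
pose s (i : 'I_k) (x : 'cV[R]_k) := 2^-1 + 2^-1 * sin (c * x i 0).
pose l := flatten [seq nseq n i | i : 'I_k].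
have count_l i : count_mem i l = n.
  rewrite count_flatten -map_comp sumnE big_map big_enum/= (bigD1 i)//= big1.
    by rewrite count_nseq/= eqxx mul1n addn0.
  by move=> j ji; rewrite count_nseq/= (negbTE ji).
have s01 x i : 0 <= s i x <= 1.
  have := sin_geN1 (c * x i 0); have := sin_le1 (c * x i 0).
  by move=> ? ?; apply/andP; split; rewrite /s; lra.
exists (fun x => bernstein (s^~ x) l (g \o node) (fun=> 0%N)); split.
- apply: bernstein_trig => i; apply: trig_add; first exact: trig_cst.
  exact/trig_scale/trig_sin.
- move=> x; rewrite -[X in `|X|]subr0.
  apply: le_trans (@bernstein_dist _ l _ _ 0 C 0 (fun=> 0) (s01 x) _ _) _ => //.
    by move=> w; rewrite mul0r addr0 subr0; exact: gC.
  by rewrite mul0r addr0.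
move=> x xL.
pose b := 2 * C / (n%:R * eta) ^+ 2.
have b0 : 0 <= b by apply: divr_ge0; [exact: mulr_ge0|exact: sqr_ge0].
have cxL i : - (pi / 2) <= c * x i 0 <= pi / 2.
  rewrite -ler_norml normrM (gtr0_norm c0).
  by apply: le_trans (ler_wpM2l (ltW c0) (xL i)) _; rewrite /c divfK// gt_eqF.
apply: le_trans (@bernstein_dist _ l _ _ (g x) (e / 2) b
  (fun i => n%:R * s i x) (s01 x) b0 _) _; last first.
  rewrite [leRHS](splitr e) lerD2l.
  apply: (@le_trans _ _ (b * (k%:R * (n%:R / 4)))).
    rewrite ler_wpM2l//.
    have -> : k%:R * (n%:R / 4) = \sum_(i < k) (n%:R / 4 : R).
      by rewrite sumr_const card_ord mulr_natl.
    apply: ler_sum => i _; rewrite count_l add0r subrr expr0n/= add0r.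
    have -> : n%:R / 4 = n%:R * (s i x * (1 - s i x) + (s i x - 2^-1) ^+ 2) by field.
    by rewrite ler_wpM2l// lerDl sqr_ge0.
  rewrite (_ : b * _ = C * k%:R / (eta ^+ 2 * e) * (e / 2 / n%:R)).
    apply: (@le_trans _ _ (n%:R * (e / 2 / n%:R))).
      by rewrite ler_wpM2r ?ltW// !divr_gt0.
    by rewrite mulrC divfK// gt_eqF.
  by rewrite /b; field; rewrite !gt_eqF.
move=> w; have := pselect (forall i, `|node w i 0 - x i 0| <= del).
case=> [near|/existsNP[i /negP]].
  apply: le_trans (gdel _ _ xL near) _.
  by rewrite lerDl mulr_ge0// sumr_ge0// => i _; exact: sqr_ge0.
rewrite -ltNge => far.
(* a node far from x in coordinate i is paid for by the i-th quadratic term *)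
have FgC : `|(g \o node) w - g x| <= 2 * C.
  by apply: le_trans (ler_normB _ _) _; rewrite mulr_natl mulr2n; apply: lerD; exact: gC.
apply: le_trans FgC _.
set S := \sum_i0 _.
suff nS : (n%:R * eta) ^+ 2 <= S.
  rewrite (_ : 2 * C = b * (n%:R * eta) ^+ 2).
    by apply: ler_wpDl; [exact: ltW|rewrite ler_wpM2l].
  by rewrite /b divfK// gt_eqF// exprn_gt0// mulr_gt0.
rewrite /S (bigD1 i)//=; apply: ler_wpDr.
  by apply: sumr_ge0 => j _; exact: sqr_ge0.
set m := minn (w i) n.
have mn : (m <= n)%N by exact: geq_minr.
have etas : eta <= `|m%:R / n%:R - s i x|.
  have := @sin_gap (asin (y m)) (c * x i 0) h.
  rewrite asin_geNpi2 ?asin_lepi2 ?y1// => /(_ isT (cxL i)).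
  rewrite asinK ?in_itv/= ?y1// => gap.
  rewrite -(@ler_pM2l _ 2)//; apply: le_trans (gap _) _.
    rewrite ltW//= (@le_trans _ _ (c * del))//; first by rewrite ge_min lexx.
    move: far; rewrite !mxE -/m -(ltr_pM2l c0) => /ltW/le_trans; apply.
    by rewrite -{1}(gtr0_norm c0) -normrM mulrBr [c * (_ / c)]mulrC divfK// gt_eqF.
  rewrite -[X in _ <= X * _](@ger0_norm _ 2)// -normrM /y /s.
  by rewrite le_eqVlt; apply/orP; left; apply/eqP; congr (`|_|); field; rewrite gt_eqF.
apply: (@le_trans _ _ ((m%:R - n%:R * s i x) ^+ 2)).
  rewrite -[leRHS]real_normK ?num_real// lerXn2r ?nnegrE//.
    by rewrite mulr_ge0// ltW.
  have -> : m%:R - n%:R * s i x = n%:R * (m%:R / n%:R - s i x).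
    by field; rewrite gt_eqF.
  by rewrite normrM (gtr0_norm n0) ler_pM2l.
have [wn|/ltnW nw] := leqP (w i) n; first by rewrite /m (minn_idPl wn).
rewrite /m (minn_idPr nw).
have /andP[si0 si1] := s01 x i.
have ns0 : 0 <= n%:R - n%:R * s i x.
  by rewrite subr_ge0 ler_piMr.
by rewrite lerXn2r ?nnegrE// ?lerD2r ?ler_nat// (le_trans ns0)// lerD2r ler_nat.
Qed.

End trigonometric_polynomials.
(** * Gaussian laws *)

Section normal_characteristic_function.
Context (R : realType).
Local Notation mu := (@lebesgue_measure R).
Local Notation phi := (normal_pdf (0 : R) 1).

Lemma Rintegral_normal (f : R -> R) : bmeas (f : measurableTypeR R -> R) ->
  \int[normal_prob (0 : R) 1]_z f z = \int[mu]_z (f z * phi z).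
Proof.
move=> bf; congr fine.
have dom : normal_prob (0 : R) 1 `<< mu by exact: normal_prob_dominates.
have mf : measurable_fun setT (EFin \o f) by apply/measurable_EFinP; case: bf.
rewrite -(Radon_Nikodym_change_of_variables dom)//=; last exact: bmeas_integrable.
apply: ae_eq_integral => //.
- exact: emeasurable_funM.
- apply/measurable_EFinP; apply: measurable_funM; first by case: bf.
  exact: measurable_normal_pdf.
under [X in ae_eq _ _ _ X]eq_fun do rewrite EFinM.
apply: ae_eqe_mul2l => /=; apply: integral_ae_eq => //.
- by apply: Radon_Nikodym_integrable; exact: normal_prob_dominates.
- by apply/measurable_EFinP; exact: measurable_normal_pdf.
- by move=> E _ mE; rewrite -Radon_Nikodym_integral//; exact: normal_prob_dominates.
Qed.

Lemma normal_pdf01E (z : R) : phi z = normal_peak 1 * expR (- (z ^+ 2 / 2)).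
Proof.
rewrite normal_pdfE ?oner_neq0// /normal_fun subr0 expr1n.
by rewrite -[1 *+ 2]/(2 : R) mulNr.
Qed.

Lemma is_derive_normal_pdf (z : R) : is_derive z 1 phi (- z * phi z).
Proof.
have -> : phi = (fun z => normal_peak 1 * expR (- (z ^+ 2 / 2))).
  by apply/funext => x; exact: normal_pdf01E.
by apply: is_derive_eq; rewrite /GRing.scale /=; field.
Qed.

(** Up to a constant, |z| phi z is at most the centred normal density of variance 2,
    since |z| exp(- z^2 / 4) is bounded. *)
Lemma integrable_norm_normal_pdf :
  mu.-integrable setT (EFin \o (fun z : R => `|z| * phi z)).
Proof.
pose s : R := Num.sqrt 2; have s0 : s != 0 by rewrite gt_eqF// sqrtr_gt0.
pose c : R := 2 * normal_peak 1 / normal_peak s.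
apply: (@le_integrable _ _ _ mu _ _ _
  (EFin \o (fun z => c * normal_pdf 0 s z))) => //.
- apply/measurable_EFinP; apply: measurable_funM; last exact: measurable_normal_pdf.
  exact: normr_measurable.
- move=> z _ /=; rewrite lee_fin ger0_norm ?mulr_ge0 ?normal_pdf_ge0//.
  apply: (le_trans _ (ler_norm _)).
  rewrite normal_pdf01E (normal_pdfE _ s0) /normal_fun subr0 sqr_sqrtr//.
  rewrite -[2 *+ 2]mulr_natr.
  have -> : - (z ^+ 2 / 2) = (- (z ^+ 2 / 4)) + (- (z ^+ 2 / 4)) :> R by field.
  have -> : - z ^+ 2 / (2 * 2) = - (z ^+ 2 / 4) by field.
  have -> : c * (normal_peak s * expR (- (z ^+ 2 / 4))) =
            2 * normal_peak 1 * expR (- (z ^+ 2 / 4)).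
    by rewrite /c; field; rewrite gt_eqF// normal_peak_gt0.
  rewrite expRD !mulrA ler_wpM2r ?expR_ge0//.
  rewrite [`|z| * _]mulrC -mulrA [2 * _]mulrC ler_wpM2l ?normal_peak_ge0//.
  rewrite expRN ler_pdivrMr ?expR_gt0//.
  apply: (@le_trans _ _ (2 * (1 + z ^+ 2 / 4))); last first.
    by rewrite ler_pM2l// expR_ge1Dx.
  have -> : z ^+ 2 = `|z| ^+ 2 by rewrite real_normK ?num_real.
  rewrite -subr_ge0.
  have -> : 2 * (1 + `|z| ^+ 2 / 4) - `|z| = 2^-1 * (`|z| - 1) ^+ 2 + 3 / 2 by field.
  have := sqr_ge0 (`|z| - 1); lra.
- exact: eq_integrable (integrableZl _ c (integrable_normal_pdf 0 s)).
Qed.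

Lemma integrable_normal_dominated (h : R -> R) (C : R) : measurable_fun setT h ->
  (forall z, `|h z| <= C * (1 + `|z|)) ->
  mu.-integrable setT (EFin \o (fun z => h z * phi z)).
Proof.
move=> mh hC.
have i1 : mu.-integrable setT (EFin \o (fun z => C * (phi z + `|z| * phi z))).
  have := integrableZl measurableT C (integrableD measurableT
    (integrable_normal_pdf 0 1) integrable_norm_normal_pdf).
  exact: eq_integrable.
apply: le_integrable i1 => //.
  apply/measurable_EFinP; apply: measurable_funM => //; exact: measurable_normal_pdf.
move=> z _ /=; rewrite lee_fin normrM (ger0_norm (normal_pdf_ge0 _ _ _)).
apply: (le_trans _ (ler_norm _)).
rewrite (_ : C * _ = C * (1 + `|z|) * phi z); last by ring.
by rewrite ler_wpM2r// normal_pdf_ge0.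
Qed.

Lemma Rintegral_derive_eq0 (G g : R -> R) : (forall z : R, is_derive z 1 G (g z)) ->
  continuous g -> mu.-integrable setT (EFin \o g) ->
  G n%:R @[n --> \oo] --> 0 -> G (- n%:R) @[n --> \oo] --> 0 ->
  \int[mu]_z g z = 0.
Proof.
move=> dG cg ig Gy GNy.
have mg : measurable_fun setT g by exact: continuous_measurable_fun.
pose I (n : nat) := `[- n%:R, n%:R]%classic : set R.
pose h n := g \_ (I n).
have mh n : measurable_fun setT (EFin \o h n).
  apply/measurable_EFinP; apply/(measurable_restrictT g); last exact: measurable_funTS.
  exact: measurable_itv.
have [|||_ _ hg] := @dominated_convergence _ _ _ mu setT measurableT
  (fun n => EFin \o h n) (EFin \o g) (EFin \o (fun z => `|g z|)) mh
  (measurable_int _ ig).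
- apply: aeW => z _; apply/cvg_EFin; first exact: nearW.
  apply: (@cvg_near_cst _ _ (g z)).
  exists (Num.truncn `|z|).+1 => // n /= zn.
  rewrite /= /h patchE; case: ifPn => // /negP[]; rewrite inE /I /= in_itv/=.
  by rewrite -ler_norml (le_trans (ltW (truncnS_gt _)))// ler_nat.
- exact: (integrable_abse ig).
- apply: aeW => z n _ /=; rewrite lee_fin /h patchE.
  by case: ifP => // _; rewrite normr0.
have GG : G n%:R - G (- n%:R) @[n --> \oo] --> 0.
  by rewrite -(subr0 0); exact: cvgB.
rewrite /Rintegral; suff -> : (\int[mu]_z (g z)%:E = 0)%E by [].
have u0 : (\int[mu]_x (EFin \o h n) x)%E @[n --> \oo] --> 0%E; last exact: cvg_unique hg u0.
rewrite -(cvg_shiftS (fun n => \int[mu]_x (EFin \o h n) x)%E) /=.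
apply: (@cvg_trans _ ((G n.+1%:R - G (- n.+1%:R))%:E @[n --> \oo])).
  apply: near_eq_cvg; apply: nearW => n.
  have n0 : - n.+1%:R < n.+1%:R :> R by rewrite gtrN// ltr0n.
  rewrite EFinB -(continuous_FTC2 n0 (f := g)).
  - by rewrite integral_mkcond; apply: eq_integral => z _; rewrite restrict_EFin.
  - exact: continuous_subspaceT.
  - split.
    + by move=> z _; exact: ex_derive.
    + by apply: cvg_at_right_filter; apply: differentiable_continuous;
        apply/derivable1_diffP; exact: ex_derive.
    + by apply: cvg_at_left_filter; apply: differentiable_continuous;
        apply/derivable1_diffP; exact: ex_derive.
  - by move=> z _; rewrite derive1E; exact: derive_val.
apply/cvg_EFin; first exact: nearW.
by rewrite (cvg_shiftS (fun n => G n%:R - G (- n%:R))).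
Qed.

End normal_characteristic_function.
Section normal_cosine.
Context (R : realType).
Local Notation mu := (@lebesgue_measure R).
Local Notation phi := (normal_pdf (0 : R) 1).
Variable th : R.
Let f (t z : R) : R := cos (t * z + th) * phi z.
Let F (t : R) : R := \int[mu]_z f t z.

Let measurable_cos_affine t : measurable_fun setT (fun z : R => cos (t * z + th)).
Proof.
by have [] // := @bmeas_cos _ _ R (fun z : R => t * z + th) _; apply: measurable_funD.
Qed.

Let integrable_f t : mu.-integrable setT (EFin \o f t).
Proof.
apply: (@integrable_normal_dominated R (fun z => cos (t * z + th)) 1) => // z.
by rewrite mul1r (le_trans (cos_max _))// lerDl.
Qed.

Let derive_f (t z : R) : is_derive t 1 (f^~ z) (- z * sin (t * z + th) * phi z).
Proof.
rewrite /f; apply: is_derive_eq; rewrite /GRing.scale /=.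
by move: (sin _) (phi z) => s p; ring.
Qed.

Let derive_F (t : R) : is_derive t 1 F (\int[mu]_z (- z * sin (t * z + th) * phi z)).
Proof.
have tI : (`](t - 1), (t + 1)[%classic : set R) t.
  by rewrite /= in_itv/= ltrBlDr ltrDl ltr01.
have d1 (x z : R) : partial1of2 f x z = - z * sin (x * z + th) * phi z.
  by rewrite /partial1of2 derive1E; apply: derive_val.
have ub x z : (`](t - 1), (t + 1)[%classic : set R) x -> setT z ->
    `|partial1of2 f x z| <= `|z| * phi z.
  move=> _ _; rewrite d1 !normrM normrN (ger0_norm (normal_pdf_ge0 _ _ _)).
  by rewrite ler_wpM2r ?normal_pdf_ge0// ler_piMr// sin_max.
have dF x z : (`](t - 1), (t + 1)[%classic : set R) x -> setT z ->
    derivable (f^~ z) x 1.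
  by move=> _ _; exact: ex_derive.
have G0 z : 0 <= `|z| * phi z by rewrite mulr_ge0// normal_pdf_ge0.
have iG := @integrable_norm_normal_pdf R.
apply: DeriveDef.
  exact: (derivable_under_integral measurableT tI (fun x _ => integrable_f x) dF G0 iG ub).
rewrite -derive1E (differentiation_under_integral measurableT tI
  (fun x _ => integrable_f x) dF G0 iG ub).
by apply: eq_Rintegral => z _; rewrite d1.
Qed.

Let cvg_normal_pdf (s : R) : `|s| = 1 -> phi (s * n%:R) @[n --> \oo] --> 0.
Proof.
move=> s1.
have s2 : s ^+ 2 = 1 by rewrite -real_normK ?num_real// s1 expr1n.
apply/cvg0P => e e0; exists (Num.truncn (2 * normal_peak 1 / e)).+1 => n nN.
have : 2 * normal_peak 1 / e < n%:R.
  by apply: lt_le_trans (truncnS_gt _) _; rewrite ler_nat.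
have n0 : 0 < n%:R :> R by rewrite ltr0n; case: (n) nN.
rewrite ger0_norm ?normal_pdf_ge0// normal_pdf01E exprMn s2 mul1r.
rewrite expRN ltr_pdivrMr// => h1.
rewrite ler_pdivrMr ?expR_gt0//.
have := expR_ge1Dx (n%:R ^+ 2 / 2 : R) => h2.
have h3 : n%:R / 2 <= expR (n%:R ^+ 2 / 2) :> R.
  apply: le_trans h2; rewrite -subr_ge0.
  have := sqr_ge0 (n%:R - 1 : R); rewrite sqrrB1; nra.
have : e * (n%:R / 2) <= e * expR (n%:R ^+ 2 / 2) by rewrite ler_pM2l.
by apply: le_trans; lra.
Qed.

(** The derivative of sin (t z + th) phi z in z has integral 0: this integration by
    parts yields the differential equation F' t = - t F t. *)
Let derive_FE t : \int[mu]_z (- z * sin (t * z + th) * phi z) = - t * F t.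
Proof.
have msin : measurable_fun setT (fun z : R => sin (t * z + th)).
  apply: (@measurableT_comp _ _ _ _ _ _ (@sin R)); last exact: measurable_funD.
  by apply: continuous_measurable_fun; exact: continuous_sin.
have i1 : mu.-integrable setT (EFin \o (fun z => - z * sin (t * z + th) * phi z)).
  apply: (@integrable_normal_dominated R (fun z => - z * sin (t * z + th)) 1).
    by apply: measurable_funM => //; exact: measurableT_comp.
  move=> z; rewrite mul1r normrM normrN.
  apply: (@le_trans _ _ `|z|); first by rewrite ler_piMr// sin_max.
  by rewrite lerDr.
have i2 : mu.-integrable setT (EFin \o (fun z => t * f t z)).
  exact: eq_integrable (integrableZl measurableT t (integrable_f t)).
suff : \int[mu]_z (t * f t z + - z * sin (t * z + th) * phi z) = 0.
  rewrite RintegralD// RintegralZl// -/(F t) => /eqP.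
  by rewrite addrC addr_eq0 mulNr => /eqP.
have cphi : continuous phi by apply: continuous_normal_pdf; exact: oner_neq0.
have ca : continuous (fun z : R => t * z + th).
  by move=> z; apply: cvgD; [apply: cvgMr; exact: cvg_id|exact: cvg_cst].
have bnd (s : R) : `|s| = 1 -> sin (t * (s * n%:R) + th) * phi (s * n%:R) @[n --> \oo] --> 0.
  move=> s1; apply/cvg0P => e e0.
  have [N phiN] := (cvg0P _).1 (cvg_normal_pdf s1) e e0.
  exists N => n Nn; apply: le_trans (phiN n Nn).
  by rewrite normrM ler_piMl// sin_max.
apply: (@Rintegral_derive_eq0 R (fun z => sin (t * z + th) * phi z)).
- move=> z; have := is_derive_normal_pdf z => dphi.
  apply: is_derive_eq; rewrite /GRing.scale /= /f.
  by move: (sin _) (cos _) (phi z) => s c p; ring.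
- move=> z; apply: cvgD.
    apply: cvgMr; apply: cvgM; last exact: cphi.
    exact: (cvg_comp _ _ (ca z) (@continuous_cos R _)).
  apply: cvgM; last exact: cphi.
  apply: cvgM; first by apply: cvgN; exact: cvg_id.
  exact: (cvg_comp _ _ (ca z) (@continuous_sin R _)).
- exact: eq_integrable (integrableD measurableT i2 i1).
- have := bnd 1 (normr1 _); by under eq_fun do rewrite mul1r.
- have := bnd (-1) (normrN1 _); by under eq_fun do rewrite mulN1r.
Qed.

Lemma normal_cos t :
  \int[normal_prob (0 : R) 1]_z cos (t * z + th) = expR (- (t ^+ 2 / 2)) * cos th.
Proof.
rewrite Rintegral_normal; last exact: bmeas_cos (measurable_funD _ _).
rewrite -[LHS]/(F t).
have dG (x : R) : is_derive x 1 (fun x => expR (x ^+ 2 / 2) * F x) (0 : R).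
  have := derive_F x; rewrite derive_FE => dFx.
  apply: is_derive_eq; rewrite /GRing.scale /=.
  by move: (expR _) (F x) => E Fx; field.
have := is_derive_0_is_cst t 0 dG.
rewrite expr0n/= mul0r expR0 mul1r => h.
have -> : F t = expR (- (t ^+ 2 / 2)) * (expR (t ^+ 2 / 2) * F t).
  by rewrite mulrA -expRD addNr expR0 mul1r.
rewrite h; congr (_ * _).
rewrite /F /f; under eq_Rintegral do rewrite mul0r add0r.
rewrite RintegralZl//; last exact: integrable_normal_pdf.
by rewrite /Rintegral integral_normal_pdf mulr1.
Qed.

End normal_cosine.
Section transfer_and_product.
Context d1 d2 (T1 : measurableType d1) (T2 : measurableType d2) (R : realType).

Lemma bmeas_comp (X : T1 -> T2) (f : T2 -> R) :
  measurable_fun setT X -> bmeas f -> bmeas (f \o X).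
Proof.
move=> mX [mf [C fC]]; split; first exact: measurableT_comp.
by exists C => x; exact: fC.
Qed.

Lemma Rintegral_distribution (m : probability T1 R) (X : {mfun T1 >-> T2})
    (f : T2 -> R) : bmeas f ->
  \int[distribution m X]_x f x = \int[m]_x f (X x).
Proof.
move=> bf; congr fine; apply: integral_distribution.
  by apply/measurable_EFinP; case: bf.
exact: (bmeas_integrable m (bmeas_comp (measurable_funPT X) bf)).
Qed.

Lemma Rintegral_prod (m1 : probability T1 R) (m2 : probability T2 R)
    (f : T1 * T2 -> R) : bmeas f ->
  \int[(m1 \x m2)%E]_p f p = \int[m1]_x \int[m2]_y f (x, y).
Proof.
move=> bf; congr fine.
have int_f := bmeas_integrable (m1 \x m2)%E bf.
rewrite -(integral12_prod_meas1 int_f); apply: eq_integral => x _.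
rewrite /fubini_F /Rintegral fineK//.
have bfx : bmeas (fun y => f (x, y)).
  case: bf => mf [C fC]; split; last by exists C.
  by apply: measurableT_comp => //; exact: measurable_pair1.
exact: integrable_fin_num (bmeas_integrable m2 bfx).
Qed.

End transfer_and_product.

Lemma Ex_cvg d (T : measurableType d) (R : realType) (m : probability T R)
    (f : nat -> T -> R) (g : T -> R) (C : R) :
  (forall n, measurable_fun setT (f n)) -> (forall n x, `|f n x| <= C) ->
  (forall x, f n x @[n --> \oo] --> g x) ->
  [/\ measurable_fun setT g, forall x, `|g x| <= C &
      \int[m]_x f n x @[n --> \oo] --> \int[m]_x g x].
Proof.
move=> mf fC fg.
have mg : measurable_fun setT g by apply: (measurable_fun_cvg mf) => x _; exact: fg.
have gC x : `|g x| <= C.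
  by apply: (cvgr_to_le (cvg_norm (fg x))); exact: nearW.
split => //.
have [|||_ _ fgi] := @dominated_convergence _ _ _ m setT measurableT
  (fun n => EFin \o f n) (EFin \o g) (EFin \o cst C)
  (fun n => (measurable_EFinP _ _).2 (mf n)) ((measurable_EFinP _ _).2 mg).
- by apply: aeW => x _; apply/cvg_EFin; [exact: nearW|exact: fg].
- exact: bmeas_integrable (bmeas_cst _ _).
- by apply: aeW => x n _; rewrite /= lee_fin.
apply: fine_cvg; rewrite /Rintegral fineK//.
exact: integrable_fin_num (bmeas_integrable m (bmeas_le mg gC)).
Qed.

Lemma bmeas_indicator_gt d (T : measurableType d) (R : realType) (h : T -> R) (L : R) :
  measurable_fun setT h -> bmeas (fun x => (L < h x)%R%:R : R).
Proof.
move=> mh; apply: (@bmeas_le _ _ _ _ 1); last first.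
  by move=> x; rewrite normr_nat lern1; case: (_ < _).
rewrite (_ : (fun _ => _) = \1_(h @^-1` `]L, +oo[%classic)).
  apply: measurable_indic; rewrite -[X in measurable X]setTI; exact: mh.
apply/funext => x; rewrite indicE; congr (_%:R); congr nat_of_bool.
by apply/idP/idP; rewrite inE /= in_itv/= andbT.
Qed.

Section gaussian_laws.
Context (R : realType).

(** The coordinates are integrated out one at a time; the shift th stands for the
    contribution of those that are still fixed. *)
Lemma std_gaussian_cos k (v : 'cV[R]_k) th :
  \int[std_gaussian k]_x cos (dot v x + th) = expR (- (dot v v / 2)) * cos th.
Proof.
elim: k v th => [|k IH] v th.
  rewrite /Rintegral /= integral_dirac//; last first.
    by apply/measurable_EFinP; have [] := bmeas_cos (measurable_funD
      (measurable_dot v) (measurable_cst th)).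
  rewrite diracT mul1e /= /dot !big_ord0.
  by rewrite mul0r oppr0 expR0 mul1r add0r.
pose v' : 'cV[R]_k := \col_i v (lift ord0 i) 0.
have dotE p : dot v (cons_col p) = v ord0 0 * p.1 + dot v' p.2.
  rewrite /dot big_ord_recl; congr (_ * _ + _).
    rewrite /cons_col (_ : ord0 = lshift k (ord0 : 'I_1)); last exact/val_inj.
    by rewrite (col_mxEu (p.1%:M : 'M[R]_1)) mxE eqxx mulr1n.
  apply: eq_bigr => i _; congr (_ * _); first by rewrite mxE.
  have -> : lift ord0 i = rshift 1 i :> 'I_(1 + k) by exact/val_inj.
  exact: (col_mxEd (p.1%:M : 'M[R]_1)).
have bcos : bmeas (fun x => cos (dot v x + th)).
  by apply: bmeas_cos; apply: measurable_funD => //; exact: measurable_dot.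
rewrite /= Rintegral_distribution// Rintegral_prod; last first.
  exact: bmeas_comp (measurable_funPT (@cons_col R k)) bcos.
have inner (x : R) : \int[std_gaussian k]_y cos (dot v (cons_col (x, y)) + th) =
    expR (- (dot v' v' / 2)) * cos (v ord0 0 * x + th).
  rewrite -IH; apply: eq_Rintegral => y _; rewrite dotE/=.
  by congr cos; ring.
under eq_Rintegral do rewrite inner.
rewrite ExZ; last by apply: bmeas_cos; apply: measurable_funD => //; exact: measurable_funM.
rewrite normal_cos mulrA -expRD; congr (expR _ * _).
rewrite [in RHS]/dot big_ord_recl -/(dot _ _) /=.
have -> : \sum_i v (lift ord0 i) 0 * v (lift ord0 i) 0 = dot v' v'.
  by apply: eq_bigr => i _; rewrite mxE.
by field.
Qed.

Lemma dot_mulmx k (A : 'M[R]_k) u x : dot u (A *m x) = dot (A^T *m u) x.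
Proof.
have dotE (a b : 'cV[R]_k) : dot a b = (a^T *m b) 0 0.
  by rewrite mxE; apply: eq_bigr => i _; rewrite mxE.
by rewrite !dotE trmx_mul trmxK mulmxA.
Qed.

Lemma mx_rootP k (S : 'M[R]_k) : (exists A : 'M[R]_k, A *m A^T = S) ->
  mx_root S *m (mx_root S)^T = S.
Proof. by move=> [A AS]; rewrite /mx_root; case: xgetP => [B -> //|/(_ A)]. Qed.

Lemma gaussian_cos k (S : 'M[R]_k) u th : (exists A : 'M[R]_k, A *m A^T = S) ->
  \int[gaussian S]_x cos (dot u x + th) = expR (- (dot u (S *m u) / 2)) * cos th.
Proof.
move=> /mx_rootP rootS; rewrite Rintegral_distribution; last first.
  by apply: bmeas_cos; apply: measurable_funD => //; exact: measurable_dot.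
under eq_Rintegral do rewrite dot_mulmx.
by rewrite std_gaussian_cos -dot_mulmx mulmxA rootS.
Qed.

(** The number of coordinates outside the interval from -L to L, as a bounded
    measurable substitute for the indicator of the complement of a cube. *)
Definition tail k (L : R) (x : 'cV[R]_k) : R := \sum_i (L < `|x i 0|)%R%:R.

Lemma bmeas_tail k L : bmeas (@tail k L).
Proof.
apply: bmeas_sum => i; apply: bmeas_indicator_gt.
by apply: measurableT_comp => //; exact: measurable_coordinate.
Qed.

Lemma tail_ge0 k L (x : 'cV[R]_k) : 0 <= tail L x.
Proof. by apply: sumr_ge0. Qed.

(** A square root of a matrix whose diagonal is bounded by 1 has entries bounded
    by 1, so that all these laws are dominated by one and the same tail of the
    standard law. *)
Lemma gaussian_tight k (e : R) : 0 < e -> exists2 L, 0 < L &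
  forall S : 'M[R]_k, (exists A : 'M[R]_k, A *m A^T = S) -> (forall i, S i i <= 1) ->
  \int[gaussian S]_x tail L x <= e.
Proof.
move=> e0.
pose h (z : 'cV[R]_k) : R := \sum_i `|z i 0|.
have mh : measurable_fun setT h.
  apply: measurable_sum => i; apply: measurableT_comp => //.
  exact: measurable_coordinate.
pose f n (z : 'cV[R]_k) : R := (n%:R < h z)%R%:R.
have bf n : bmeas (f n) by exact: bmeas_indicator_gt.
have [_ _ fcvg] : [/\ measurable_fun setT (fun _ : 'cV[R]_k => 0 : R),
    forall x : 'cV[R]_k, `|0 : R| <= 1 &
    \int[std_gaussian k]_x f n x @[n --> \oo] --> \int[std_gaussian k]_x 0].
  apply: (@Ex_cvg _ _ _ (std_gaussian k) f).
  - by move=> n; case: (bf n).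
  - by move=> n x; rewrite normr_nat lern1; case: (_ < _).
  - move=> x; apply: cvg_near_cst; exists (Num.truncn (h x)).+1 => // n /= xn.
    rewrite /f ltNge (le_trans (ltW (truncnS_gt _)))//.
    by rewrite ler_nat.
move: fcvg; rewrite Ex_cst => /cvg0P /(_ (e / k.+1%:R)).
rewrite divr_gt0// => /(_ isT)[N fN].
exists N.+1%:R => // S /mx_rootP rootS S1.
rewrite Rintegral_distribution; last exact: bmeas_tail.
have root1 i j : `|mx_root S i j| <= 1.
  rewrite -(@ler_pXn2r _ 2)// ?nnegrE// expr1n real_normK ?num_real//.
  apply: le_trans (S1 i); have /matrixP/(_ i i) <- := rootS.
  rewrite mxE (bigD1 j)//= mxE -expr2 lerDl.
  by apply: sumr_ge0 => l _; rewrite mxE -expr2 sqr_ge0.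
apply: (@le_trans _ _ (\int[std_gaussian k]_z (k%:R * f N.+1 z))).
  apply: Ex_le; [|by apply: bmeasZ|].
    exact: (bmeas_comp (measurable_funPT (mulmx (mx_root S) : 'cV[R]_k -> 'cV[R]_k))
      (bmeas_tail _ _)).
  move=> z; have -> : k%:R * f N.+1 z = \sum_(i < k) f N.+1 z.
    by rewrite sumr_const card_ord mulr_natl.
  apply: ler_sum => i _; rewrite ler_nat.
  case: (ltP N.+1%:R `|(mx_root S *m z) i 0|) => //= zi.
  rewrite (lt_le_trans zi)//= mxE (le_trans (ler_norm_sum _ _ _))//.
  by apply: ler_sum => j _; rewrite normrM ler_piMl.
rewrite ExZ//; have := fN N.+1 (leqnSn N).
rewrite ger0_norm; last by apply: Rintegral_ge0 => x _; exact: ler0n.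
rewrite ler_pdivlMr// mulrC; apply: le_trans; rewrite ler_wpM2r ?ler_nat//.
by apply: Rintegral_ge0 => x _; exact: ler0n.
Qed.

End gaussian_laws.
(** * A continuity theorem for stable convergence *)

Section continuous_functions.
Context (R : realType) (k : nat).
Implicit Types g t : 'cV[R]_k -> R.

(** The measurable structure is generated by the coordinates, so that continuity
    yields measurability only through an approximation argument. *)
Lemma continuous_bmeas g C : continuous g -> (forall x, `|g x| <= C) -> bmeas g.
Proof.
move=> cg gC; apply: (bmeas_le _ gC).
have ex n : exists t : 'cV[R]_k -> R, trig t /\
    forall x : 'cV[R]_k, (forall i, `|x i 0| <= n.+1%:R) -> `|t x - g x| <= n.+1%:R^-1.
  have [t [tt _ tg]] := @trig_approx R k g C n.+1%:R n.+1%:R^-1 cg gC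
    (ltr0Sn _ _) (ltac:(by rewrite invr_gt0)).
  by exists t.
have [t tg] := choice ex.
apply: (@measurable_fun_cvg _ _ _ _ t) => [n|x _].
  by have [/trig_bmeas[]] := tg n.
apply/subr_cvg0/cvg0P => e e0.
pose M : R := \sum_i `|x i 0| + e^-1.
exists (Num.truncn M) => n Mn.
have Mn1 : M <= n.+1%:R.
  by apply: le_trans (ltW (truncnS_gt _)) _; rewrite ler_nat.
have s0 : 0 <= \sum_i `|x i 0| by apply: sumr_ge0.
apply: le_trans ((tg n).2 x _) _.
  move=> i; apply: le_trans Mn1; apply: ler_wpDr; first by rewrite invr_ge0 ltW.
  by rewrite (bigD1 i)//= lerDl; apply: sumr_ge0.
rewrite -[e]invrK lef_pV2 ?posrE ?invr_gt0//.
by apply: le_trans Mn1; rewrite /M lerDr.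
Qed.

Lemma tail_approx g t C L e : 0 <= e -> 0 <= C ->
  (forall x, `|g x| <= C) -> (forall x, `|t x| <= C) ->
  (forall x : 'cV[R]_k, (forall i, `|x i 0| <= L) -> `|t x - g x| <= e) ->
  forall x, `|t x - g x| <= e + 2 * C * tail L x.
Proof.
move=> e0 C0 gC tC tg x.
have := pselect (forall i, `|x i 0| <= L); case=> [xL|/existsNP[i /negP]].
  by apply: ler_wpDr (tg x xL); rewrite mulr_ge0 ?tail_ge0// mulr_ge0.
rewrite -ltNge => Lx; apply: ler_wpDl => //.
apply: (@le_trans _ _ (2 * C)).
  by apply: le_trans (ler_normB _ _) _; rewrite mulr_natl mulr2n; exact: lerD.
rewrite ler_peMr ?mulr_ge0// /tail (bigD1 i)//= Lx lerDl.
by apply: sumr_ge0.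
Qed.

Lemma tail_le L L' (x : 'cV[R]_k) : L <= L' -> tail L' x <= tail L x.
Proof.
move=> LL; apply: ler_sum => i _; rewrite ler_nat.
by case: (ltP L') => //= /(le_lt_trans LL) ->.
Qed.

Lemma tail_le_sqr L (x : 'cV[R]_k) : 1 <= L -> tail L x <= L^-1 * \sum_i x i 0 ^+ 2.
Proof.
move=> L1; rewrite mulr_sumr; apply: ler_sum => i _.
have L0 : 0 < L := lt_le_trans ltr01 L1.
case: ltP => [Lx|_] /=; last by rewrite mulr_ge0 ?sqr_ge0// invr_ge0 ltW.
rewrite ler_pdivlMl// mulr1 -real_normK ?num_real// expr2.
rewrite -[leLHS]mulr1; apply: ler_pM => //; [exact: ltW|exact: ltW|].
exact: le_trans (ltW Lx).
Qed.

End continuous_functions.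

Lemma bounded_setT (T : Type) (R : realType) (f : T -> R) :
  [bounded f x | x in setT] -> exists2 C, 0 <= C & forall x, `|f x| <= C.
Proof.
move=> bf; have [C fC] := @filter_ex _ (+oo%R : set_system R) _ _ bf.
by exists `|C| => // x; apply: le_trans (ler_norm C); exact: fC.
Qed.

Lemma expectationE d (T : measurableType d) (R : realType) (P : probability T R)
  (X : T -> R) : bmeas X -> ('E_P[X] = (\int[P]_w X w)%:E)%E.
Proof.
move=> bX; rewrite unlock /Rintegral fineK//.
exact: integrable_fin_num (bmeas_integrable P bX).
Qed.

Section stable_continuity_theorem.
Context d (T : measurableType d) (R : realType) (P : probability T R) (k : nat).
Variables (Y : nat -> T -> 'cV[R]_k) (S : T -> 'M[R]_k) (c : R).
Hypothesis bY : forall n i, bmeas (fun w => Y n w i 0).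
Hypothesis mS : forall i j, measurable_fun setT (fun w => S w i j).
Hypothesis rootS : forall w, exists A : 'M[R]_k, A *m A^T = S w.
Hypothesis diagS : forall w i, S w i i <= 1.
Hypothesis momY : forall n i, \int[P]_w (Y n w i 0 ^+ 2) <= c.
Hypothesis cosY : forall u th (Z : T -> R), bmeas Z ->
  \int[P]_w (Z w * cos (dot u (Y n w) + th)) @[n --> \oo] -->
  \int[P]_w (Z w * (expR (- (dot u (S w *m u) / 2)) * cos th)).

Let mY n : measurable_fun setT (Y n).
Proof. by apply: measurable_colvecP => i; case: (bY n i). Qed.

Let mean t w : R := \int[gaussian (S w)]_x t x.

Lemma trig_stable_cvg t : trig t -> bmeas (mean t) /\
  forall Z, bmeas Z -> \int[P]_w (Z w * t (Y n w)) @[n --> \oo] -->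
    \int[P]_w (Z w * mean t w).
Proof.
elim=> [u th|f1 f2 t1 [b1 cv1] t2 [b2 cv2]|a f1 t1 [b1 cv1]].
- have meanE w : mean (fun x => cos (dot u x + th)) w =
      expR (- (dot u (S w *m u) / 2)) * cos th by exact: gaussian_cos.
  split.
    apply: (@bmeas_le _ _ _ _ 1) => [|w].
      rewrite (_ : mean _ = (fun w => expR (- (dot u (S w *m u) / 2)) * cos th)).
        apply: measurable_funM => //; apply: measurableT_comp => //.
        apply: measurableT_comp => //; apply: measurable_funM => //.
        apply: measurable_sum => i; apply: measurable_funM => //.
        rewrite (_ : (fun x => _) = (fun w => \sum_j S w i j * u j 0)).
          by apply: measurable_sum => j; exact: measurable_funM.
        by apply/funext => w; rewrite mxE.
      by apply/funext => w; exact: meanE.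
    apply: Ex_norm_le_cst => [|x]; last exact: cos_max.
    by apply: trig_bmeas; exact: trig_cos.
  by move=> Z bZ; under eq_Rintegral do rewrite meanE; exact: cosY.
- have meanE w : mean (fun x => f1 x + f2 x) w = mean f1 w + mean f2 w.
    by apply: ExD; exact: trig_bmeas.
  split; first by rewrite (_ : mean _ = fun w => mean f1 w + mean f2 w);
    [exact: bmeasD|exact/funext].
  move=> Z bZ; under eq_Rintegral do rewrite meanE mulrDr.
  rewrite ExD; [|exact: bmeasM|exact: bmeasM].
  rewrite (_ : (fun n => _) = (fun n =>
      \int[P]_w (Z w * f1 (Y n w)) + \int[P]_w (Z w * f2 (Y n w)))).
    exact: cvgD (cv1 Z bZ) (cv2 Z bZ).
  apply/funext => n; under eq_Rintegral do rewrite mulrDr.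
  by rewrite ExD//; apply: bmeasM => //; apply: (bmeas_comp (mY n)); exact: trig_bmeas.
- have meanE w : mean (fun x => a * f1 x) w = a * mean f1 w.
    by apply: ExZ; exact: trig_bmeas.
  split; first by rewrite (_ : mean _ = fun w => a * mean f1 w);
    [exact: bmeasZ|exact/funext].
  move=> Z bZ; have := cv1 (fun w => Z w * a) (bmeasM bZ (bmeas_cst T a)).
  under eq_fun do (under eq_Rintegral do rewrite -mulrA).
  by under eq_Rintegral do rewrite -mulrA -meanE.
Qed.

Lemma trig_approx_means g C e : continuous g -> (forall x, `|g x| <= C) -> 0 < e ->
  exists2 t, trig t & (forall w, `|mean t w - mean g w| <= e) /\
    forall n, \int[P]_w `|t (Y n w) - g (Y n w)| <= e.
Proof.
move=> cg gC e0; have C0 : 0 <= C := le_trans (normr_ge0 _) (gC 0).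
have bg := continuous_bmeas cg gC.
have e20 : 0 < e / 2 by rewrite divr_gt0.
pose a := e / 2 / (2 * C + 1).
have C1 : 0 < 2 * C + 1 by rewrite ltr_wpDl// mulr_ge0.
have a0 : 0 < a by rewrite divr_gt0.
have Ca : 2 * C * a <= e / 2.
  have -> : e / 2 = (2 * C + 1) * a by rewrite /a; field; rewrite gt_eqF.
  by rewrite ler_wpM2r// ?ltW// ltrDl.
have [L1 L10 tight] := gaussian_tight k a0.
pose L2 : R := Num.max 1 (k%:R * c / a).
pose L := Num.max L1 L2.
have L21 : 1 <= L2 by rewrite le_max lexx.
have L0 : 0 < L by rewrite lt_max L10.
have [t [tt tC tg]] := trig_approx cg gC L0 e20.
have bt := trig_bmeas tt.
have tailB := tail_approx (ltW e20) C0 gC tC tg.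
have btail : bmeas (fun x : 'cV[R]_k => e / 2 + 2 * C * tail L x).
  by apply: bmeasD; [exact: bmeas_cst|apply: bmeasZ; exact: bmeas_tail].
exists t => //; split => [w|n].
  rewrite /mean -ExB//; apply: le_trans (Ex_norm_le _ (bmeasB bt bg) btail tailB) _.
  rewrite ExD; [|exact: bmeas_cst|by apply: bmeasZ; exact: bmeas_tail].
  rewrite Ex_cst ExZ; last exact: bmeas_tail.
  rewrite [leRHS](splitr e) lerD2l.
  apply: le_trans Ca; rewrite ler_wpM2l ?mulr_ge0//.
  apply: le_trans (tight _ (rootS w) (diagS w)).
  apply: Ex_le; [exact: bmeas_tail|exact: bmeas_tail|move=> x].
  by apply: tail_le; rewrite le_max lexx.
have btY : bmeas (fun w => tail L (Y n w)) := bmeas_comp (mY n) (bmeas_tail k L).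
apply: (@le_trans _ _ (\int[P]_w (e / 2 + 2 * C * tail L (Y n w)))).
  apply: Ex_le.
  - by apply: bmeas_norm; apply: bmeasB; exact: (bmeas_comp (mY n)).
  - by apply: bmeasD; [exact: bmeas_cst|exact: bmeasZ].
  - by move=> w; exact: tailB.
rewrite ExD; [|exact: bmeas_cst|exact: bmeasZ].
rewrite Ex_cst ExZ// [leRHS](splitr e) lerD2l.
apply: le_trans Ca; rewrite ler_wpM2l ?mulr_ge0//.
have bsum : bmeas (fun w => \sum_i Y n w i 0 ^+ 2).
  by apply: bmeas_sum => i; exact: bmeasX.
apply: (@le_trans _ _ (\int[P]_w (L2^-1 * \sum_i Y n w i 0 ^+ 2))).
  apply: Ex_le => //; first exact: bmeasZ.
  move=> w; apply: le_trans (tail_le_sqr _ L21); apply: tail_le.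
  by rewrite le_max lexx orbT.
rewrite ExZ// Ex_sum; last by move=> i; exact: bmeasX.
have L20 : 0 < L2 := lt_le_trans ltr01 L21.
rewrite ler_pdivrMl//; apply: (@le_trans _ _ (k%:R * c)).
  rewrite mulr_natl -[k in leRHS]card_ord -sumr_const.
  by apply: ler_sum => i _; exact: momY.
by rewrite -ler_pdivrMr// le_max lexx orbT.
Qed.

(** By linearity the hypothesis on cosines extends to all trigonometric
    polynomials.  These approximate a bounded continuous g uniformly on large
    cubes while keeping its bound, and the mass outside the cubes is uniformly
    small: on the side of Y by the moment bound, on the Gaussian side because
    the diagonal of S is bounded. *)
Lemma stable_cvg_of_cos : stable_cvg_gaussian P Y S.
Proof.
move=> g Z cg /bounded_setT[C C0 gC] /bounded_setT[D D0 ZD].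
have bZ : bmeas Z by split; [exact: measurable_funPT|exists D].
have bg := continuous_bmeas cg gC.
have bmean : bmeas (mean g).
  apply: (@bmeas_le _ _ _ _ C) => [|w]; last exact: Ex_norm_le_cst.
  have ex n : exists t, trig t /\ forall w, `|mean t w - mean g w| <= n.+1%:R^-1.
    have [t tt [tg _]] := trig_approx_means cg gC
      (ltac:(by rewrite invr_gt0) : 0 < n.+1%:R^-1).
    by exists t.
  have [t tg] := choice ex.
  apply: (@measurable_fun_cvg _ _ _ _ (fun n => mean (t n))) => [n|w _].
    by have [tn _] := tg n; have [[]] := trig_stable_cvg tn.
  apply/subr_cvg0/cvg0P => e e0; exists (Num.truncn e^-1) => n en.
  apply: le_trans ((tg n).2 w) _.
  rewrite -[leRHS]invrK lef_pV2 ?posrE ?invr_gt0//.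
  by apply: le_trans (ltW (truncnS_gt _)) _; rewrite ler_nat.
have bgY n : bmeas (fun w => g (Y n w)) := bmeas_comp (mY n) bg.
rewrite [in X in _ --> X]expectationE; last exact: bmeasM.
rewrite (_ : (fun N => _) = (fun N => (\int[P]_w (Z w * g (Y N w)))%:E)); last first.
  by apply/funext => N; rewrite expectationE//; exact: bmeasM.
apply/cvg_EFin; first exact: nearW.
apply/subr_cvg0/cvg0P => e e0.
pose a := e / 3 / (D + 1).
have D1 : 0 < D + 1 by rewrite ltr_wpDl.
have a0 : 0 < a by rewrite !divr_gt0.
have Da : D * a <= e / 3.
  rewrite /a mulrCA -[leRHS]mulr1 ler_wpM2l ?divr_ge0 ?(ltW e0)//.
  by rewrite ler_pdivrMr// mul1r lerDl.
have [t tt [tmean tY]] := trig_approx_means cg gC a0.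
have [bmt cvt] := trig_stable_cvg tt.
have btY n : bmeas (fun w => t (Y n w)) := bmeas_comp (mY n) (trig_bmeas tt).
have [N tN] := (cvg0P _).1 ((subr_cvg0 _ _).2 (cvt Z bZ)) (e / 3)
  (ltac:(by rewrite divr_gt0)).
exists N => n Nn; rewrite /=.
have ZmE : `|\int[P]_w (Z w * mean t w) - \int[P]_w (Z w * mean g w)| <= e / 3.
  apply: le_trans Da; apply: Ex_dist; [exact: bmeasM|exact: bmeasM|move=> w].
  by rewrite -mulrBr normrM; apply: ler_pM.
have ZYE : `|\int[P]_w (Z w * t (Y n w)) - \int[P]_w (Z w * g (Y n w))| <= e / 3.
  rewrite -ExB; [|exact: bmeasM|exact: bmeasM].
  apply: (@le_trans _ _ (\int[P]_w (D * `|t (Y n w) - g (Y n w)|))).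
    apply: Ex_norm_le.
    - by apply: bmeasB; exact: bmeasM.
    - by apply: bmeasZ; apply: bmeas_norm; exact: bmeasB.
    - by move=> w; rewrite -mulrBr normrM ler_wpM2r.
  rewrite ExZ; last by apply: bmeas_norm; exact: bmeasB.
  by apply: le_trans Da; rewrite ler_wpM2l.
have := tN n Nn; rewrite /= => tZ.
apply: le_trans (ler_distD (\int[P]_w (Z w * t (Y n w))) _ _) _.
rewrite distrC in ZYE.
apply: le_trans (lerD ZYE (ler_distD (\int[P]_w (Z w * mean t w)) _ _)) _.
apply: le_trans (lerD (lexx _) (lerD tZ ZmE)) _.
by rewrite le_eqVlt; apply/orP; left; apply/eqP; field.
Qed.

End stable_continuity_theorem.
(** * Paths of the urn *)

Lemma cvg_col (R : realType) (k : nat) (f : nat -> 'cV[R]_k) (l : 'cV[R]_k) :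
  (forall i, f n i 0 @[n --> \oo] --> l i 0) -> f n @[n --> \oo] --> l.
Proof.
move=> fl; apply/cvgrPdist_le => e e0.
have ex i : exists N, forall n, (N <= n)%N -> `|l i 0 - f n i 0| <= e.
  have /cvgrPdist_le/(_ e e0)[N _ H] := fl i.
  by exists N => n Nn; exact: H.
have [N fN] := choice ex.
exists (\max_i N i)%N => // n /= Nn.
rewrite [leLHS]/Num.norm /= mx_normrE.
apply/bigmax_leP; split => [|[i j] _ /=]; first exact: ltW.
by rewrite ord1 !mxE; apply: fN; apply: leq_trans Nn; exact: leq_bigmax.
Qed.

Section rate.
Context (R : realType) (r : R).
Hypothesis r01 : 0 < r < 1.

Lemma cvg_rate (c : R) : c * r ^+ n @[n --> \oo] --> 0.
Proof.
have /andP[r0 r1] := r01.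
rewrite -[X in _ --> X](mulr0 c); apply: cvgM; first exact: cvg_cst.
by apply: cvg_expr; rewrite gtr0_norm.
Qed.

Lemma eq0_of_rate (x c : R) : (forall n, `|x| <= c * r ^+ n) -> x = 0.
Proof.
move=> xc; apply/eqP; rewrite -normr_le0; apply: (cvgr_to_ge (@cvg_rate c)).
exact: nearW.
Qed.

Lemma cvg_of_rate (u : nat -> R) (l c : R) :
  (forall n, `|u n - l| <= c * r ^+ n) -> u n @[n --> \oo] --> l.
Proof.
move=> ul; apply/subr_cvg0/cvg0P => e e0.
have [N cN] := (cvg0P _).1 (@cvg_rate c) e e0.
exists N => n Nn; apply: le_trans (ul n) _; apply: le_trans (ler_norm _) _.
exact: cN.
Qed.

Lemma geometric_sum_le n : \sum_(j < n) r ^+ j <= (1 - r)^-1.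
Proof.
have /andP[r0 r1] := r01.
have r10 : 0 < 1 - r by rewrite subr_gt0.
rewrite -[leRHS]mul1r ler_pdivlMr// mulrC -opprB mulNr -subrX1 opprB.
by rewrite gerBl exprn_ge0// ltW.
Qed.

(** The partial sums increase, whereas a partial sum plus the largest possible
    remainder decreases. *)
Lemma weighted_geometric_cvg (u : nat -> R) : (forall j, 0 <= u j <= 1) ->
  exists2 l, \sum_(j < n) r ^+ j.+1 * u j @[n --> \oo] --> l &
    forall n, 0 <= l - \sum_(j < n) r ^+ j.+1 * u j <= r ^+ n * (r / (1 - r)).
Proof.
have /andP[r0 r1] := r01.
have r10 : 0 < 1 - r by rewrite subr_gt0.
move=> u01; pose s n := \sum_(j < n) r ^+ j.+1 * u j.
pose t n := s n + r ^+ n * (r / (1 - r)).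
have sS n : s n <= s n.+1.
  rewrite /s big_ord_recr lerDl mulr_ge0 ?exprn_ge0 ?(ltW r0)//.
  by case/andP: (u01 n).
have tS n : t n.+1 <= t n.
  have -> : t n.+1 = t n - r ^+ n.+1 * (1 - u n).
    rewrite /t /s big_ord_recr /= !exprS; field.
    by rewrite gt_eqF.
  rewrite gerBl mulr_ge0 ?exprn_ge0 ?(ltW r0)// subr_ge0.
  by case/andP: (u01 n).
have nds : nondecreasing_seq s by apply/nondecreasing_seqP.
have nit : nonincreasing_seq t by apply/nonincreasing_seqP.
have st n m : s n <= t m.
  apply: (@le_trans _ _ (s (maxn n m))); first by apply: nds; exact: leq_maxl.
  apply: (@le_trans _ _ (t (maxn n m))); last by apply: nit; exact: leq_maxr.
  by rewrite lerDl mulr_ge0 ?exprn_ge0 ?(ltW r0)// divr_ge0// ltW.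
have cs : cvgn s.
  apply: nondecreasing_is_cvgn => //; exists (t 0%N); move=> y [j _ <-]; exact: st.
exists (limn s) => // n; apply/andP; split.
  by rewrite subr_ge0; exact: nondecreasing_cvgn_le.
rewrite lerBlDl; apply: (limr_le cs); apply: nearW => m; exact: st.
Qed.

End rate.

Section urn_paths.
Context d (T : measurableType d) (R : realType) (P : probability T R) (k : nat).
Variables (alpha beta : R) (b0 B0 : 'cV[R]_k) (xi : nat -> {RV P >-> 'cV[R]_k}).
Hypothesis alpha_gt0 : 0 < alpha.
Hypothesis beta_gt1 : 1 < beta.
Hypothesis hurn : rescaled_polya_urn alpha beta b0 B0 xi.

Local Notation r := beta^-1.
Local Notation psi := (urn_psi alpha beta b0 B0 xi).
Local Notation psioo := (psi_infty alpha beta B0 xi).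

Let beta_gt0 : 0 < beta := lt_trans ltr01 beta_gt1.
Let beta_neq0 : beta != 0 := lt0r_neq0 beta_gt0.
Let beta1_gt0 : 0 < beta - 1. Proof. by rewrite subr_gt0. Qed.
Let r01 : 0 < r < 1. Proof. by rewrite invr_gt0 beta_gt0 invf_lt1. Qed.

Lemma urn_rate01 : 0 < r < 1. Proof. exact: r01. Qed.

Lemma draw_basis n w : exists i, xi n.+1 w = canonical_basis i.
Proof. by have [_ _ _ + _] := hurn; apply. Qed.

Lemma draw01 n w i : 0 <= xi n.+1 w i 0 <= 1.
Proof.
have [j ->] := draw_basis n w; rewrite mxE andbT.
by case: (i == j) => /=; rewrite ?lexx ?ler01.
Qed.

Lemma draw_sum1 n w : \sum_i xi n.+1 w i 0 = 1.
Proof.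
have [j ->] := draw_basis n w; rewrite (bigD1 j)//= big1 ?addr0 ?mxE ?eqxx// => i ij.
by rewrite mxE (negbTE ij).
Qed.

Definition discounted n w i : R := \sum_(j < n) r ^+ j.+1 * xi j.+1 w i 0.

Lemma urn_BE n w i : urn_B alpha beta B0 xi n w i 0 =
  beta ^+ n * (B0 i 0 + alpha * discounted n w i).
Proof.
elim: n => [|n IH] /=; first by rewrite /discounted big_ord0 mulr0 addr0 mul1r.
rewrite !mxE IH /discounted big_ord_recr /= exprS !exprVn.
by rewrite !exprS; field; rewrite expf_neq0 beta_neq0.
Qed.

Lemma discounted_sum n w : \sum_i discounted n w i = (1 - r ^+ n) / (beta - 1).
Proof.
rewrite exchange_big /=; under eq_bigr do rewrite -mulr_sumr draw_sum1 mulr1.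
elim: n => [|n IH]; first by rewrite big_ord0 expr0 subrr mul0r.
rewrite big_ord_recr IH /= exprS; field.
by rewrite beta_neq0 gt_eqF.
Qed.

Lemma discounted_ge0 n w i : 0 <= discounted n w i.
Proof.
apply: sumr_ge0 => j _; rewrite mulr_ge0 ?exprn_ge0 ?invr_ge0 ?(ltW beta_gt0)//.
by case/andP: (draw01 j w i).
Qed.

Let b0_ge0 i : 0 <= b0 i 0. Proof. by have [/(_ i)[]] := hurn. Qed.
Let B0_ge0 i : 0 <= B0 i 0. Proof. by have [/(_ i)[]] := hurn. Qed.
Let l1b0 : l1norm b0 = \sum_i b0 i 0.
Proof. by apply: eq_bigr => i _; rewrite ger0_norm. Qed.
Let l1B0 : l1norm B0 = \sum_i B0 i 0.
Proof. by apply: eq_bigr => i _; rewrite ger0_norm. Qed.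
Let l1b0_gt0 : 0 < l1norm b0. Proof. by have [_] := hurn. Qed.
Let l1B0_ge0 : 0 <= l1norm B0. Proof. by apply: sumr_ge0. Qed.

Lemma urn_N_ge0 n w i : 0 <= urn_N alpha beta b0 B0 xi n w i 0.
Proof.
rewrite mxE urn_BE addr_ge0// mulr_ge0 ?exprn_ge0 ?(ltW beta_gt0)// addr_ge0//.
by rewrite mulr_ge0 ?(ltW alpha_gt0)// discounted_ge0.
Qed.

Lemma urn_N_norm n w : l1norm (urn_N alpha beta b0 B0 xi n w) =
  l1norm b0 + beta ^+ n * (l1norm B0 + alpha * ((1 - r ^+ n) / (beta - 1))).
Proof.
rewrite {1}/l1norm; under eq_bigr do rewrite ger0_norm ?urn_N_ge0// mxE urn_BE.
rewrite big_split/= -l1b0; congr (_ + _).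
by rewrite -mulr_sumr big_split/= -l1B0 -mulr_sumr discounted_sum.
Qed.

Let urn_N_norm_gt0 n w : 0 < l1norm (urn_N alpha beta b0 B0 xi n w).
Proof.
rewrite urn_N_norm ltr_wpDr// mulr_ge0 ?exprn_ge0 ?(ltW beta_gt0)// addr_ge0//.
have /andP[r0 r1] := r01.
rewrite mulr_ge0 ?(ltW alpha_gt0)// divr_ge0 ?(ltW beta1_gt0)// subr_ge0.
by rewrite exprn_ile1// ltW.
Qed.

Lemma urn_psi_ge0 n w i : 0 <= psi n w i 0.
Proof. by rewrite mxE mulr_ge0 ?urn_N_ge0// invr_ge0 ltW. Qed.

Lemma urn_psi_sum1 n w : \sum_i psi n w i 0 = 1.
Proof.
under eq_bigr do rewrite mxE; rewrite -mulr_sumr.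
have -> : \sum_i urn_N alpha beta b0 B0 xi n w i 0 = l1norm (urn_N alpha beta b0 B0 xi n w).
  by apply: eq_bigr => i _; rewrite ger0_norm// urn_N_ge0.
by rewrite mulVf// gt_eqF.
Qed.

Lemma discounted_cvg w : exists2 l : 'cV[R]_k,
  \big[+%R/0]_(1 <= n <oo) (beta ^- n *: xi n w) = l &
  forall n i, 0 <= l i 0 - discounted n w i <= r ^+ n / (beta - 1).
Proof.
have ex i := weighted_geometric_cvg r01 (fun j => draw01 j w i).
have /choice[l lP] : forall i, exists l,
    discounted n w i @[n --> \oo] --> l /\
    forall n, 0 <= l - discounted n w i <= r ^+ n / (beta - 1).
  move=> i; have [l cl lB] := ex i; exists l; split => // n.
  rewrite (_ : (beta - 1)^-1 = r / (1 - r)); first exact: lB.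
  by field; rewrite beta_neq0 gt_eqF.
exists (\col_i l i); last by move=> n i; rewrite mxE; case: (lP i).
apply/cvg_lim; first exact: norm_hausdorff.
rewrite -cvg_shiftS; apply: cvg_col => i; rewrite mxE.
rewrite (_ : (fun n => _) = (fun n => discounted n w i)); first by case: (lP i).
apply/funext => n; rewrite summxE big_add1 /= big_mkord.
by apply: eq_bigr => j _; rewrite mxE exprVn.
Qed.

Let Doo : R := l1norm B0 + alpha / (beta - 1).
Let Doo_gt0 : 0 < Doo.
Proof. by rewrite ltr_wpDl// divr_gt0. Qed.

Definition psi_const : R := 2 * (l1norm b0 + alpha / (beta - 1)) / Doo.

Lemma psi_const_ge0 : 0 <= psi_const.
Proof.
rewrite /psi_const divr_ge0 ?(ltW Doo_gt0)// mulr_ge0// addr_ge0 ?(ltW l1b0_gt0)//.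
by rewrite divr_ge0 ?ltW.
Qed.

Lemma urn_psi_le1 n w i : psi n w i 0 <= 1.
Proof.
rewrite -(urn_psi_sum1 n w) (bigD1 i)//= lerDl; apply: sumr_ge0 => j _.
exact: urn_psi_ge0.
Qed.

(** After division by beta ^ n the numerator of psi n is B0 + alpha * discounted n
    up to O (beta ^ -n), and its denominator is a constant up to the same order;
    discounted n misses its limit by a geometric tail.  As the draws are bounded,
    no constant depends on w. *)
Lemma urn_psi_rate n w i : `|psi n w i 0 - psioo w i 0| <= psi_const * r ^+ n.
Proof.
have [l lE lB] := discounted_cvg w.
have -> : psioo w i 0 = Doo^-1 * (B0 i 0 + alpha * l i 0).
  by rewrite /psi_infty lE !mxE.
set p := psi n w i 0; set x := discounted n w i; set a := alpha / (beta - 1).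
have pE : p * (r ^+ n * l1norm b0 + Doo - r ^+ n * a) =
    r ^+ n * b0 i 0 + (B0 i 0 + alpha * x).
  have -> : r ^+ n * l1norm b0 + Doo - r ^+ n * a =
      r ^+ n * l1norm (urn_N alpha beta b0 B0 xi n w).
    rewrite urn_N_norm /Doo /a exprVn; field.
    by rewrite expf_neq0// gt_eqF.
  rewrite /p mxE mxE urn_BE -/x exprVn; field.
  by rewrite expf_neq0// gt_eqF ?urn_N_norm_gt0.
have rn0 : 0 <= r ^+ n by rewrite exprn_ge0// invr_ge0 ltW.
rewrite /psi_const mulrAC ler_pdivlMr// -{2}(gtr0_norm Doo_gt0) -normrM.
have -> : (p - Doo^-1 * (B0 i 0 + alpha * l i 0)) * Doo =
    r ^+ n * b0 i 0 - alpha * (l i 0 - x) - p * (r ^+ n * l1norm b0) + p * (r ^+ n * a).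
  rewrite mulrBl mulrAC mulVf ?gt_eqF// mul1r.
  have -> : p * Doo = r ^+ n * b0 i 0 + (B0 i 0 + alpha * x)
     - p * (r ^+ n * l1norm b0) + p * (r ^+ n * a) by rewrite -pE; ring.
  by ring.
have p0 : 0 <= p by exact: urn_psi_ge0.
have p1 : p <= 1 by exact: urn_psi_le1.
have a0 : 0 <= a by rewrite divr_ge0 ?ltW.
have b0n : b0 i 0 <= l1norm b0.
  by rewrite l1b0 (bigD1 i)//= lerDl; apply: sumr_ge0.
have lx : 0 <= alpha * (l i 0 - x) <= r ^+ n * a.
  have /andP[lx0 lx1] := lB n i.
  by rewrite mulr_ge0 ?(ltW alpha_gt0)//= /a mulrCA ler_wpM2l ?(ltW alpha_gt0).
have h1 : 0 <= r ^+ n * b0 i 0 <= r ^+ n * l1norm b0.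
  by rewrite mulr_ge0//= ler_wpM2l.
have h2 : 0 <= p * (r ^+ n * l1norm b0) <= r ^+ n * l1norm b0.
  have rb0 : 0 <= r ^+ n * l1norm b0 by rewrite mulr_ge0// ltW.
  by rewrite mulr_ge0//= ler_piMl.
have h3 : 0 <= p * (r ^+ n * a) <= r ^+ n * a.
  have ra0 : 0 <= r ^+ n * a by rewrite mulr_ge0.
  by rewrite mulr_ge0//= ler_piMl.
have -> : 2 * (l1norm b0 + a) * r ^+ n =
  r ^+ n * l1norm b0 + r ^+ n * l1norm b0 + r ^+ n * a + r ^+ n * a by ring.
have bound (x1 x2 x3 x4 x5 x6 : R) : 0 <= x1 <= x2 -> 0 <= x3 <= x2 ->
    0 <= x4 <= x5 -> 0 <= x6 <= x5 -> `|x1 - x6 - x3 + x4| <= x2 + x2 + x5 + x5.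
  by move=> *; rewrite ler_norml; apply/andP; split; lra.
exact: bound.
Qed.

Lemma psi_infty_sum1 w : \sum_i psioo w i 0 = 1.
Proof.
apply/eqP; rewrite -subr_eq0; apply/eqP.
apply: (eq0_of_rate r01 (c := k%:R * psi_const)) => n.
rewrite -[X in _ - X](urn_psi_sum1 n w) -sumrB; apply: le_trans (ler_norm_sum _ _ _) _.
have -> : k%:R * psi_const * r ^+ n = \sum_(i < k) psi_const * r ^+ n.
  by rewrite sumr_const card_ord -[RHS]mulr_natl mulrA.
apply: ler_sum => i _.
by rewrite distrC; exact: urn_psi_rate.
Qed.

Lemma psi_infty_ge0 w i : 0 <= psioo w i 0.
Proof.
have [l lE lB] := discounted_cvg w.
rewrite /psi_infty lE !mxE mulr_ge0 ?invr_ge0 ?(ltW Doo_gt0)// addr_ge0//.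
rewrite mulr_ge0 ?(ltW alpha_gt0)//.
by have := lB 0%N i; rewrite /discounted big_ord0 subr0 => /andP[].
Qed.

Lemma urn_psi_cvg w : psi n w @[n --> \oo] --> psioo w.
Proof. by apply: cvg_col => i; apply: (cvg_of_rate r01) => n; exact: urn_psi_rate. Qed.

End urn_paths.
(** * Conditioning on the first draws *)

Lemma sigma_algebra_forall_ord (T : Type) (F : set (set T)) n (A : 'I_n -> set T) :
  sigma_algebra setT F -> (forall j, F (A j)) -> F [set w | forall j, A j w].
Proof.
move=> [F0 FC FU] FA.
pose B (m : nat) : set T := if insub m is Some j then ~` A j else set0.
have -> : [set w | forall j, A j w] = setT `\` \bigcup_m B m.
  apply/seteqP; split => [w Aw|w [_ nB] j].
    split => // -[m _]; rewrite /B; case: insubP => // j _ _ nA; exact/nA/Aw.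
  apply: contrapT => nA; apply: nB; exists (val j) => //.
  by rewrite /B valK.
apply: (FC _ _); apply: FU => m; rewrite /B; case: insubP => [j _ _|_] //.
by rewrite -setTD; exact: FC.
Qed.

Section conditioning.
Context d (T : measurableType d) (R : realType) (P : probability T R) (k : nat).
Variables (alpha beta : R) (b0 B0 : 'cV[R]_k) (xi : nat -> {RV P >-> 'cV[R]_k}).
Hypothesis hurn : rescaled_polya_urn alpha beta b0 B0 xi.
Local Notation psi := (urn_psi alpha beta b0 B0 xi).

(** Measurability with respect to the first n draws.  The draws take finitely many
    values, so that functional dependence captures it; in this form it is visibly
    preserved by all pointwise operations. *)
Definition history (U : Type) (n : nat) (X : T -> U) : Prop :=
  forall w w', (forall j, (j < n)%N -> xi j.+1 w = xi j.+1 w') -> X w = X w'.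

Lemma history_le U m n (X : T -> U) : (m <= n)%N -> history m X -> history n X.
Proof. by move=> mn hX w w' ww'; apply: hX => j jm; apply/ww'/(leq_trans jm). Qed.

Lemma history_draw n : history n.+1 (xi n.+1).
Proof. by move=> w w'; apply; exact: ltnSn. Qed.

Lemma history_urn_psi n : history n (psi n).
Proof.
suff hB : history n (urn_B alpha beta B0 xi n).
  by move=> w w' ww'; rewrite /urn_psi /urn_N (hB w w' ww').
elim: n => [//|n IH] w w' ww' /=.
by rewrite (IH w w') ?ww'// => j jn; apply: ww'; exact: ltnW.
Qed.

Definition cylinder n (a : {ffun 'I_n -> 'I_k}) : set T :=
  [set w | forall j : 'I_n, xi j.+1 w = canonical_basis (a j)].

Let basis_inj (i j : 'I_k) : canonical_basis i = canonical_basis j :> 'cV[R]_k -> i = j.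
Proof.
move=> /matrixP/(_ i 0); rewrite !mxE !eqxx /= andbT.
by case: eqVneq => // _ /eqP; rewrite oner_eq0.
Qed.

Lemma cylinder_filtration n (a : {ffun 'I_n -> 'I_k}) : urn_filtration xi n (cylinder a).
Proof.
have sigF : sigma_algebra setT (urn_filtration xi n).
  exact: smallest_sigma_algebra.
apply: (sigma_algebra_forall_ord sigF) => j.
apply: sub_sigma_algebra; rewrite -bigcup_seq; exists j; first by rewrite /= mem_index_enum.
exists [set canonical_basis (a j)]; last by rewrite setTI.
rewrite (_ : [set _] = [set x : 'cV[R]_k | forall i,
    x i 0 = (canonical_basis (a j) : 'cV[R]_k) i 0]).
  apply: (sigma_algebra_forall_ord (@sigma_algebra_measurable _ _)) => i.
  have := @measurable_coordinate R k i measurableT [set (canonical_basis (a j) : 'cV[R]_k) i 0]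
    (measurable_set1 _).
  by rewrite setTI.
apply/seteqP; split => [x -> //|x xE].
by apply/matrixP => i l; rewrite (ord1 l).
Qed.

Lemma urn_filtration_measurable n : urn_filtration xi n `<=` measurable.
Proof.
apply: smallest_sub; first exact: sigma_algebra_measurable.
move=> A; rewrite -bigcup_seq => -[j _ [B mB <-]].
exact: measurable_funPT.
Qed.

(** There are finitely many cylinders and X is constant on each; so the axiom on
    conditional probabilities, which speaks of events, applies to X. *)
Lemma history_simple n (X : T -> R) : history n X ->
  exists x : {ffun 'I_n -> 'I_k} -> R,
    forall w, X w = \sum_a x a * \1_(cylinder a) w.
Proof.
move=> hX.
exists (fun a => if pselect (exists w, cylinder a w) is left aw
                 then X (projT1 (cid aw)) else 0) => w.
have [f fE] := choice (fun j => draw_basis hurn j w).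
pose a := [ffun j : 'I_n => f j].
have aw : cylinder a w by move=> j; rewrite ffunE fE.
rewrite (bigD1 a)//= big1 ?addr0 => [|a' a'a].
  rewrite indicE mem_set// mulr1; case: pselect => [aw'|]; last by case; exists w.
  case: cid => w' /= aw''; apply: hX => j jn.
  by rewrite (aw (Ordinal jn)) (aw'' (Ordinal jn)).
rewrite indicE memNset ?mulr0// => a'w; move/eqP: a'a; apply.
apply/ffunP => j; apply: basis_inj; rewrite -a'w; exact: aw.
Qed.

Lemma history_bmeas n (X : T -> R) : history n X -> bmeas X.
Proof.
move=> /history_simple[x xE]; rewrite (_ : X = fun w => \sum_a x a * \1_(cylinder a) w).
  apply: bmeas_sum => a; apply: bmeasZ; apply: (@bmeas_le _ _ _ _ 1).
    by apply: measurable_indic; apply: urn_filtration_measurable; exact: cylinder_filtration.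
  by move=> w; rewrite indicE normr_nat lern1; case: (_ \in _).
exact/funext.
Qed.

Lemma draw_bmeas n i : bmeas (fun w => xi n.+1 w i 0).
Proof.
by apply: (@history_bmeas n.+1) => w w' ww'; rewrite (history_draw ww').
Qed.

Lemma urn_psi_bmeas n i : bmeas (fun w => psi n w i 0).
Proof. by apply: (@history_bmeas n) => w w' ww'; rewrite (history_urn_psi ww'). Qed.

Lemma expectation_draw n i X : history n X ->
  \int[P]_w (X w * xi n.+1 w i 0) = \int[P]_w (X w * psi n w i 0).
Proof.
move=> hX; have [x xE] := history_simple hX.
have bC (a : {ffun 'I_n -> 'I_k}) : bmeas (\1_(cylinder a) : T -> R).
  apply: (@bmeas_le _ _ _ _ 1).
    by apply: measurable_indic; apply: urn_filtration_measurable; exact: cylinder_filtration.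
  by move=> w; rewrite indicE normr_nat lern1; case: (_ \in _).
have expand (Y : T -> R) : bmeas Y ->
    \int[P]_w (X w * Y w) = \sum_a x a * \int[P]_w (\1_(cylinder a) w * Y w).
  move=> bY; under eq_Rintegral do rewrite xE mulr_suml.
  rewrite Ex_sum; last by move=> a; apply: bmeasM => //; exact: bmeasZ.
  apply: eq_bigr => a _; under eq_Rintegral do rewrite -mulrA.
  by rewrite ExZ//; exact: bmeasM.
rewrite !expand; [|exact: urn_psi_bmeas|exact: draw_bmeas].
apply: eq_bigr => a _; congr (_ * _).
have mC : measurable (cylinder a).
  by apply: urn_filtration_measurable; exact: cylinder_filtration.
have [_ _ _ _ /(_ n i)[_ _ /(_ _ (cylinder_filtration a))]] := hurn.
set E := [set w | _] => PE.
have mE : measurable E.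
  have := (draw_bmeas n i).1 measurableT [set (1 : R)] (measurable_set1 _).
  by rewrite setTI.
have -> : \int[P]_w (\1_(cylinder a) w * psi n w i 0) = fine (P (cylinder a `&` E)).
  rewrite -PE; congr fine; rewrite [RHS]integral_mkcond; apply: eq_integral => w _.
  by rewrite patchE indicE; case: ifPn => _; rewrite ?mul1r ?mul0r.
congr fine.
have -> : P (cylinder a `&` E) = (\int[P]_w (\1_(cylinder a `&` E) w)%:E)%E.
  by rewrite integral_indic ?setIT//; exact: measurableI.
apply: eq_integral => w _; congr (_%:E).
have E01 : xi n.+1 w i 0 = \1_E w.
  rewrite indicE; have [j jE] := draw_basis hurn n w.
  have [ij|ij] := eqVneq i j.
    by rewrite mem_set /E/= jE mxE ij eqxx.
  by rewrite memNset /E/= jE mxE (negbTE ij)// => /esym/eqP; rewrite oner_eq0.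
by rewrite E01 !indicE in_setI -natrM mulnb.
Qed.

(** Given the past, draw n + 1 has law psi n; so a variable that depends on the
    past and on this draw may first be averaged over the latter. *)
Lemma expectation_next n (X : T -> R) (Phi : 'I_k -> T -> R) :
  (forall i, history n (Phi i)) ->
  (forall w i, xi n.+1 w = canonical_basis i -> X w = Phi i w) ->
  \int[P]_w X w = \int[P]_w (\sum_i psi n w i 0 * Phi i w).
Proof.
move=> hPhi XPhi.
have bPhi i : bmeas (Phi i) := history_bmeas (hPhi i).
transitivity (\int[P]_w (\sum_i Phi i w * xi n.+1 w i 0)).
  apply: eq_Rintegral => w _; have [j jE] := draw_basis hurn n w.
  rewrite (XPhi w j jE) (bigD1 j)//= big1 ?addr0 => [|i ij].
    by rewrite jE mxE !eqxx mulr1.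
  by rewrite jE mxE (negbTE ij) mulr0.
have bd i := draw_bmeas n i; have bp i := urn_psi_bmeas n i.
rewrite !Ex_sum; try by move=> i; exact: bmeasM.
apply: eq_bigr => i _; rewrite expectation_draw//.
by apply: eq_Rintegral => w _; rewrite mulrC.
Qed.

End conditioning.
(** * Second order expansion of one step *)

Section elementary_bounds.
Context (R : realType).

(** The mean value theorem, in the form that turns a bound on the derivative into
    one of the next order; it yields the successive Taylor remainders below. *)
Lemma derive_power_bound (f g : R -> R) (C : R) (m : nat) :
  (forall x : R, is_derive x 1 f (g x)) -> f 0 = 0 -> 0 <= C ->
  (forall x, `|g x| <= C * `|x| ^+ m) -> forall x, `|f x| <= C * `|x| ^+ m.+1.
Proof.
move=> df f0 C0 gC x.
have cf : continuous f.
  move=> y; apply: differentiable_continuous; apply/derivable1_diffP.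
  exact: ex_derive.
have bound c : `|c| <= `|x| -> `|g c * x| <= C * `|x| ^+ m.+1.
  move=> cx; rewrite normrM exprSr mulrA ler_wpM2r//.
  by apply: le_trans (gC c) _; rewrite ler_wpM2l// lerXn2r// nnegrE.
have [x0|/ltW x0] := leP 0 x.
  have [c /[!in_itv]/= /andP[c0 cx] fE] :=
    MVT_segment x0 (fun y _ => df y) (continuous_subspaceT cf).
  rewrite f0 !subr0 in fE; rewrite fE; apply: bound.
  by rewrite !ger0_norm.
have [c /[!in_itv]/= /andP[cx c0] fE] :=
  MVT_segment x0 (fun y _ => df y) (continuous_subspaceT cf).
rewrite f0 !sub0r mulrN in fE; rewrite (oppr_inj fE); apply: bound.
by rewrite !ler0_norm// lerN2.
Qed.

Lemma sin_le_norm (x : R) : `|sin x| <= `|x|.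
Proof.
rewrite -[leRHS]mul1r -[X in 1 * X]expr1; apply: (@derive_power_bound sin cos 1 0).
- exact: sin0.
- exact: ler01.
- by move=> y; rewrite expr0 mulr1; exact: cos_max.
Qed.

Lemma cos_sub1_bound (x : R) : `|cos x - 1| <= `|x| ^+ 2.
Proof.
rewrite -[leRHS]mul1r.
apply: (@derive_power_bound (fun x => cos x - 1) (fun x => - sin x) 1 1).
- by move=> y; apply: is_derive_eq; rewrite /GRing.scale /=; ring.
- by rewrite cos0 subrr.
- exact: ler01.
- by move=> y; rewrite normrN mul1r expr1; exact: sin_le_norm.
Qed.

Lemma sin_sub_bound (x : R) : `|sin x - x| <= `|x| ^+ 3.
Proof.
rewrite -[leRHS]mul1r.
apply: (@derive_power_bound (fun x => sin x - x) (fun x => cos x - 1) 1 2).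
- by rewrite subr0 sin0.
- exact: ler01.
- by move=> y; rewrite mul1r; exact: cos_sub1_bound.
Qed.

Lemma cos_expansion_bound (x : R) : `|cos x - 1 + x ^+ 2 / 2| <= `|x| ^+ 4.
Proof.
rewrite -[leRHS]mul1r; apply: (@derive_power_bound (fun x => cos x - 1 + x ^+ 2 / 2)
  (fun x => - (sin x - x)) 1 3).
- by move=> y; apply: is_derive_eq; rewrite /GRing.scale /=; field.
- by rewrite cos0 subrr add0r expr0n mul0r.
- exact: ler01.
- by move=> y; rewrite mul1r normrN; exact: sin_sub_bound.
Qed.

Lemma cos_taylor (t x : R) :
  `|cos (t + x) - (cos t - x * sin t - x ^+ 2 / 2 * cos t)| <= `|x| ^+ 3 + `|x| ^+ 4.
Proof.
have -> : cos (t + x) - (cos t - x * sin t - x ^+ 2 / 2 * cos t) =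
    - (sin t * (sin x - x)) + cos t * (cos x - 1 + x ^+ 2 / 2) by rewrite cosD; ring.
apply: le_trans (ler_normD _ _) _; rewrite normrN !normrM; apply: lerD.
  by rewrite -[leRHS]mul1r; apply: ler_pM => //; [exact: sin_max|exact: sin_sub_bound].
by rewrite -[leRHS]mul1r; apply: ler_pM => //; [exact: cos_max|exact: cos_expansion_bound].
Qed.

Lemma cos_lipschitz (x y : R) : `|cos x - cos y| <= `|x - y|.
Proof.
have -> : cos x - cos y = cos (y + (x - y)) - cos y by rewrite subrKC.
rewrite -[leRHS]mul1r -[X in 1 * X]expr1.
apply: (@derive_power_bound (fun z => cos (y + z) - cos y) (fun z => - sin (y + z)) 1 0).
- by move=> z; apply: is_derive_eq; rewrite /GRing.scale /=; ring.
- by rewrite addr0 subrr.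
- exact: ler01.
- by move=> z; rewrite expr0 mulr1 normrN; exact: sin_max.
Qed.

Lemma expRN_le1 (x : R) : 0 <= x -> 0 <= expR (- x) <= 1.
Proof. by move=> x0; rewrite expR_ge0 /= -[leRHS]expR0 ler_expR oppr_le0. Qed.

Lemma expRN_lipschitz (x y : R) : 0 <= x -> 0 <= y ->
  `|expR (- x) - expR (- y)| <= `|x - y|.
Proof.
wlog xy : x y / x <= y => [W x0 y0|x0 y0].
  have [xy|/ltW yx] := leP x y; first exact: W.
  by rewrite distrC [leRHS]distrC; exact: W.
have := expR_ge1Dx (- (y - x)).
have := expRN_le1 x0 => /andP[e0 e1] h.
have -> : expR (- y) = expR (- x) * expR (- (y - x)) by rewrite -expRD; congr expR; ring.
rewrite -[X in `|X - _|]mulr1 -mulrBr normrM (ger0_norm e0).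
rewrite [leRHS]distrC (@ger0_norm _ (y - x)) ?subr_ge0//.
have yx0 : 0 <= y - x by rewrite subr_ge0.
have /andP[_ h1] := expRN_le1 yx0.
rewrite ger0_norm ?subr_ge0//.
rewrite -[leRHS]mul1r; apply: ler_pM => //; rewrite ?subr_ge0//; lra.
Qed.

Lemma expRN_expansion (x : R) : 0 <= x -> `|expR (- x) - (1 - x)| <= x ^+ 2.
Proof.
move=> x0; have h := expR_ge1Dx (- x).
rewrite ger0_norm ?subr_ge0//.
have := expR_ge1Dx x => h2.
have : expR (- x) <= (1 + x)^-1.
  by rewrite expRN lef_pV2 ?posrE ?expR_gt0// ltr_pwDl.
have : (1 + x)^-1 <= 1 - x + x ^+ 2.
  rewrite -[leLHS]mul1r ler_pdivrMr ?ltr_pwDl//.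
  have -> : (1 - x + x ^+ 2) * (1 + x) = 1 + x ^+ 3 by ring.
  by rewrite lerDl exprn_ge0.
lra.
Qed.

End elementary_bounds.

Section simplex.
Context (R : realType) (k : nat) (u : 'cV[R]_k).
Implicit Types p q : 'cV[R]_k.

Definition prob_vector p : Prop := (forall i, 0 <= p i 0) /\ \sum_i p i 0 = 1.

(** The variance of u under p. *)
Definition quad p : R := \sum_i p i 0 * u i 0 ^+ 2 - dot u p ^+ 2.

Definition l1 : R := \sum_i `|u i 0|.

Lemma l1_ge0 : 0 <= l1. Proof. exact: sumr_ge0. Qed.

Lemma coord_le_l1 i : `|u i 0| <= l1.
Proof. by rewrite /l1 (bigD1 i)//= lerDl; exact: sumr_ge0. Qed.

Lemma mean_le p (f : 'I_k -> R) (C : R) : prob_vector p -> (forall i, `|f i| <= C) ->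
  `|\sum_i p i 0 * f i| <= C.
Proof.
move=> [p0 p1] fC; apply: le_trans (ler_norm_sum _ _ _) _.
rewrite -[leRHS]mul1r -p1 mulr_suml; apply: ler_sum => i _.
by rewrite normrM ger0_norm// ler_wpM2l.
Qed.

Lemma dotE p : dot u p = \sum_i p i 0 * u i 0.
Proof. by apply: eq_bigr => i _; rewrite mulrC. Qed.

Lemma dot_prob_le p : prob_vector p -> `|dot u p| <= l1.
Proof. by move=> pp; rewrite dotE; apply: mean_le => //; exact: coord_le_l1. Qed.

Lemma centered_le p i : prob_vector p -> `|u i 0 - dot u p| <= 2 * l1.
Proof.
move=> pp; apply: le_trans (ler_normB _ _) _; rewrite mulr_natl mulr2n.
by apply: lerD; [exact: coord_le_l1|exact: dot_prob_le].
Qed.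

Lemma mean_centered p : prob_vector p -> \sum_i p i 0 * (u i 0 - dot u p) = 0.
Proof.
move=> [_ p1]; under eq_bigr do rewrite mulrBr.
by rewrite sumrB -mulr_suml p1 mul1r -dotE subrr.
Qed.

Lemma mean_centered_sqr p : prob_vector p ->
  \sum_i p i 0 * (u i 0 - dot u p) ^+ 2 = quad p.
Proof.
move=> [_ p1]; rewrite /quad.
rewrite (eq_bigr (fun i => p i 0 * u i 0 ^+ 2 - 2 * dot u p * (p i 0 * u i 0) +
  dot u p ^+ 2 * p i 0)); last by move=> i _; ring.
rewrite big_split/= sumrB -!mulr_sumr -dotE p1; ring.
Qed.

Lemma quad_bound p : prob_vector p -> 0 <= quad p <= (2 * l1) ^+ 2.
Proof.
move=> pp; rewrite -mean_centered_sqr//; apply/andP; split.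
  by apply: sumr_ge0 => i _; rewrite mulr_ge0 ?sqr_ge0//; case: pp.
apply: le_trans (ler_norm _) _; apply: mean_le => // i.
by rewrite normrX lerXn2r ?nnegrE ?mulr_ge0 ?l1_ge0// centered_le.
Qed.

Lemma dot_lipschitz p q (e : R) : (forall i, `|p i 0 - q i 0| <= e) ->
  `|dot u p - dot u q| <= l1 * e.
Proof.
move=> pq; rewrite -dotBr; apply: le_trans (ler_norm_sum _ _ _) _.
rewrite mulr_suml; apply: ler_sum => i _.
by rewrite normrM !mxE ler_wpM2l.
Qed.

Lemma quad_lipschitz p q (e : R) : prob_vector p -> prob_vector q ->
  (forall i, `|p i 0 - q i 0| <= e) -> 0 <= e -> `|quad p - quad q| <= 3 * l1 ^+ 2 * e.
Proof.
move=> pp qq pq e0.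
have -> : quad p - quad q = \sum_i (p i 0 - q i 0) * u i 0 ^+ 2 -
    (dot u p - dot u q) * (dot u p + dot u q).
  by rewrite /quad; under [X in _ = X - _]eq_bigr do rewrite mulrBl; rewrite sumrB; ring.
apply: le_trans (ler_normB _ _) _.
have -> : 3 * l1 ^+ 2 * e = l1 * (l1 * e) + (l1 * e) * (2 * l1) by ring.
apply: lerD.
  apply: le_trans (ler_norm_sum _ _ _) _; rewrite [leRHS]mulr_suml.
  apply: ler_sum => i _; rewrite normrM normrX mulrC expr2 -mulrA.
  by apply: ler_wpM2l => //; apply: ler_pM => //; exact: coord_le_l1.
rewrite normrM; apply: ler_pM => //; first exact: dot_lipschitz.
apply: le_trans (ler_normD _ _) _; rewrite mulr_natl mulr2n.
by apply: lerD; exact: dot_prob_le.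
Qed.

(** One step of the walk with increments u i - dot u p, of size a: its first two
    moments match those hidden in the factor exp (- a^2 quad p / 2). *)
Lemma mean_cos_step p (a t : R) : prob_vector p -> 0 <= a ->
  `|\sum_i p i 0 * cos (t + a * (u i 0 - dot u p)) -
    cos t * expR (- (a ^+ 2 / 2 * quad p))|
  <= (a * (2 * l1)) ^+ 3 + 2 * (a * (2 * l1)) ^+ 4.
Proof.
move=> pp a0; set K := 2 * l1; set x := a ^+ 2 / 2 * quad p.
have K0 : 0 <= K by rewrite mulr_ge0// l1_ge0.
pose v i := a * (u i 0 - dot u p).
have vK i : `|v i| <= a * K.
  by rewrite normrM (ger0_norm a0) ler_wpM2l// centered_le.
have /andP[q0 qK] := quad_bound pp.
have x0 : 0 <= x by rewrite !mulr_ge0// exprn_ge0.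
have xK : x <= (a * K) ^+ 2.
  rewrite exprMn; apply: ler_pM => //; first by rewrite mulr_ge0// exprn_ge0.
  by rewrite ler_pdivrMr// ler_peMr ?exprn_ge0// ler1n.
have main : \sum_i p i 0 * (cos t - v i * sin t - v i ^+ 2 / 2 * cos t) = cos t * (1 - x).
  rewrite (eq_bigr (fun i => cos t * p i 0 - a * sin t * (p i 0 * (u i 0 - dot u p)) -
    a ^+ 2 / 2 * cos t * (p i 0 * (u i 0 - dot u p) ^+ 2))); last first.
    by move=> i _; rewrite /v; ring.
  rewrite !sumrB -!mulr_sumr mean_centered// mean_centered_sqr//.
  by case: pp => _ ->; rewrite /x; ring.
have -> : \sum_i p i 0 * cos (t + v i) - cos t * expR (- x) =
    \sum_i p i 0 * (cos (t + v i) - (cos t - v i * sin t - v i ^+ 2 / 2 * cos t)) -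
    cos t * (expR (- x) - (1 - x)).
  under [X in _ = X - _]eq_bigr do rewrite mulrBr.
  by rewrite sumrB main; ring.
apply: le_trans (ler_normB _ _) _.
have -> : (a * K) ^+ 3 + 2 * (a * K) ^+ 4 =
    ((a * K) ^+ 3 + (a * K) ^+ 4) + 1 * ((a * K) ^+ 2) ^+ 2 by ring.
apply: lerD.
  apply: mean_le => // i; apply: le_trans (cos_taylor _ _) _.
  have aK0 : 0 <= a * K by exact: mulr_ge0.
  apply: lerD; (apply: lerXn2r; [exact: normr_ge0|exact: aK0|exact: vK]).
rewrite normrM; apply: ler_pM => //; first exact: cos_max.
apply: le_trans (expRN_expansion x0) _.
by rewrite lerXn2r ?nnegrE// exprn_ge0// mulr_ge0.
Qed.

End simplex.
(** * The martingale part of the empirical mean *)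

Section martingale.
Context d (T : measurableType d) (R : realType) (P : probability T R) (k : nat).
Variables (alpha beta : R) (b0 B0 : 'cV[R]_k) (xi : nat -> {RV P >-> 'cV[R]_k}).
Hypothesis alpha_gt0 : 0 < alpha.
Hypothesis beta_gt1 : 1 < beta.
Hypothesis hurn : rescaled_polya_urn alpha beta b0 B0 xi.
Variable u : 'cV[R]_k.

Local Notation r := beta^-1.
Local Notation psi := (urn_psi alpha beta b0 B0 xi).
Local Notation psioo := (psi_infty alpha beta B0 xi).
Local Notation history := (history xi).
Local Notation K := (2 * l1 u).
Local Notation q n w := (quad u (psi n w)).
Local Notation qoo w := (quad u (psioo w)).

Let r01 : 0 < r < 1 := urn_rate01 beta_gt1.
Let psi_hist n : history n (psi n).
Proof. exact: history_urn_psi. Qed.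
Let K_ge0 : 0 <= K. Proof. by rewrite mulr_ge0// l1_ge0. Qed.

Lemma psi_prob n w : prob_vector (psi n w).
Proof.
split; last exact (urn_psi_sum1 alpha_gt0 beta_gt1 hurn n w).
exact: (urn_psi_ge0 alpha_gt0 beta_gt1 hurn n w).
Qed.

Lemma psioo_prob w : prob_vector (psioo w).
Proof.
split; last exact: (psi_infty_sum1 alpha_gt0 beta_gt1 hurn w).
exact: (psi_infty_ge0 alpha_gt0 beta_gt1 hurn w).
Qed.

Definition quad_const : R := 3 * l1 u ^+ 2 * psi_const alpha beta b0 B0.

Lemma quad_const_ge0 : 0 <= quad_const.
Proof.
apply: mulr_ge0; last exact: (psi_const_ge0 alpha_gt0 beta_gt1 hurn).
by rewrite mulr_ge0// sqr_ge0.
Qed.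

Lemma quad_rate n w : `|q n w - qoo w| <= quad_const * r ^+ n.
Proof.
rewrite /quad_const -mulrA; apply: quad_lipschitz.
- exact: psi_prob.
- exact: psioo_prob.
- by move=> i; exact: (urn_psi_rate alpha_gt0 beta_gt1 hurn).
- have /andP[r0 _] := r01.
  apply: mulr_ge0; last by rewrite exprn_ge0 ?(ltW r0).
  exact: (psi_const_ge0 alpha_gt0 beta_gt1 hurn).
Qed.

Definition walk n w : R := \sum_(j < n) (dot u (xi j.+1 w) - dot u (psi j w)).

Lemma walkS n w : walk n.+1 w = walk n w + (dot u (xi n.+1 w) - dot u (psi n w)).
Proof. by rewrite /walk big_ord_recr. Qed.

Lemma walkS_basis n w i : xi n.+1 w = canonical_basis i ->
  walk n.+1 w = walk n w + (u i 0 - dot u (psi n w)).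
Proof.
move=> xiE; rewrite walkS xiE; congr (_ + (_ - _)).
rewrite /dot (bigD1 i)//= big1 ?addr0 ?mxE ?eqxx ?mulr1// => j ji.
by rewrite mxE (negbTE ji) mulr0.
Qed.

Lemma history_walk n : history n (walk n).
Proof.
move=> w w' ww'; apply: eq_bigr => j _; rewrite ww'//.
by rewrite (@psi_hist j w w')// => i ij; apply/ww'/(ltn_trans ij).
Qed.

Lemma walk_bmeas n : bmeas (walk n).
Proof. exact: (history_bmeas hurn (@history_walk n)). Qed.

Lemma walk_step_bound n w : `|dot u (xi n.+1 w) - dot u (psi n w)| <= K.
Proof.
have [i iE] := draw_basis hurn n w.
have -> : dot u (xi n.+1 w) - dot u (psi n w) = u i 0 - dot u (psi n w).
  have := walkS_basis iE; rewrite walkS => /addrI. by [].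
by apply: centered_le; exact: psi_prob.
Qed.

Lemma walk_bound n w : `|walk n w| <= n%:R * K.
Proof.
elim: n => [|n IH]; first by rewrite /walk big_ord0 normr0 mul0r.
rewrite walkS -natr1 mulrDl mul1r; apply: le_trans (ler_normD _ _) _.
by apply: lerD => //; exact: walk_step_bound.
Qed.

(** The steps are centred given the past, hence orthogonal. *)
Lemma walk_moment2 n : \int[P]_w (walk n w ^+ 2) <= n%:R * K ^+ 2.
Proof.
elim: n => [|n IH].
  by under eq_Rintegral do rewrite /walk big_ord0 expr0n; rewrite Ex_cst mul0r.
rewrite (@expectation_next _ _ _ _ _ _ _ _ _ _ hurn n (fun w => walk n.+1 w ^+ 2)
  (fun i w => (walk n w + (u i 0 - dot u (psi n w))) ^+ 2)).
- rewrite -natr1 mulrDl mul1r.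
  apply: (@le_trans _ _ (\int[P]_w (walk n w ^+ 2 + K ^+ 2))); last first.
    rewrite ExD; [|by apply: bmeasX; exact: walk_bmeas|exact: bmeas_cst].
    by rewrite Ex_cst lerD2r.
  apply: Ex_le.
  + apply: bmeas_sum => i; apply: bmeasM; first exact: (urn_psi_bmeas hurn).
    apply: bmeasX; apply: bmeasD; first exact: walk_bmeas.
    apply: (history_bmeas hurn (n := n)) => w w' ww'.
    by rewrite (psi_hist ww').
  + by apply: bmeasD; [apply: bmeasX; exact: walk_bmeas|exact: bmeas_cst].
  move=> w; have pp := psi_prob n w.
  rewrite (eq_bigr (fun i => psi n w i 0 * walk n w ^+ 2 +
    2 * walk n w * (psi n w i 0 * (u i 0 - dot u (psi n w))) +
    psi n w i 0 * (u i 0 - dot u (psi n w)) ^+ 2)); last by move=> i _; ring.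
  rewrite !big_split/= -mulr_suml -mulr_sumr mean_centered// mean_centered_sqr//.
  case: (pp) => _ ->; rewrite mul1r mulr0 addr0 lerD2l.
  by have /andP[] := quad_bound u pp.
- move=> i w w' ww'; rewrite (history_walk ww') (psi_hist ww')//.
- by move=> w i iE; rewrite (walkS_basis iE).
Qed.

Lemma walk_moment4 n : \int[P]_w (walk n w ^+ 4) <= 4 * n%:R ^+ 2 * K ^+ 4.
Proof.
elim: n => [|n IH].
  by under eq_Rintegral do rewrite /walk big_ord0 expr0n; rewrite Ex_cst expr0n mulr0 mul0r.
rewrite (@expectation_next _ _ _ _ _ _ _ _ _ _ hurn n (fun w => walk n.+1 w ^+ 4)
  (fun i w => (walk n w + (u i 0 - dot u (psi n w))) ^+ 4)).
- have bw := walk_bmeas n.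
  apply: (@le_trans _ _ (\int[P]_w (walk n w ^+ 4 +
      (8 * K ^+ 2 * walk n w ^+ 2 + 3 * K ^+ 4)))).
    apply: Ex_le.
    + apply: bmeas_sum => i; apply: bmeasM; first exact: (urn_psi_bmeas hurn).
      apply: bmeasX; apply: bmeasD; first exact: walk_bmeas.
      apply: (history_bmeas hurn (n := n)) => w w' ww'.
      by rewrite (psi_hist ww').
    + by solve_bmeas.
    move=> w; have pp := psi_prob n w.
    set s := walk n w.
    rewrite (eq_bigr (fun i => psi n w i 0 * (s ^+ 4) +
      4 * s ^+ 3 * (psi n w i 0 * (u i 0 - dot u (psi n w))) +
      psi n w i 0 * (6 * s ^+ 2 * (u i 0 - dot u (psi n w)) ^+ 2 +
        4 * s * (u i 0 - dot u (psi n w)) ^+ 3 + (u i 0 - dot u (psi n w)) ^+ 4)));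
      last by move=> i _; ring.
    rewrite !big_split/= -mulr_suml -mulr_sumr mean_centered//.
    case: (pp) => _ ->; rewrite mul1r mulr0 addr0 lerD2l.
    apply: le_trans (ler_norm _) _; apply: mean_le => // i.
    set x := u i 0 - dot u (psi n w).
    have xK : `|x| <= K by exact: centered_le.
    have x2 : x ^+ 2 <= K ^+ 2.
      by rewrite -(real_normK (num_real x)) lerXn2r ?nnegrE.
    rewrite ger0_norm; last first.
      have -> : 6 * s ^+ 2 * x ^+ 2 + 4 * s * x ^+ 3 + x ^+ 4 =
        x ^+ 2 * (2 * s ^+ 2 + (2 * s + x) ^+ 2) by ring.
      apply: mulr_ge0; first exact: sqr_ge0.
      by apply: addr_ge0; [apply: mulr_ge0 => //|]; exact: sqr_ge0.
    (* 4 s x <= 2 s^2 + 2 x^2 *)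
    apply: (@le_trans _ _ (x ^+ 2 * (8 * s ^+ 2 + 3 * x ^+ 2))).
      have -> : 6 * s ^+ 2 * x ^+ 2 + 4 * s * x ^+ 3 + x ^+ 4 =
        x ^+ 2 * (6 * s ^+ 2 + 4 * s * x + x ^+ 2) by ring.
      rewrite ler_wpM2l ?sqr_ge0//; have := sqr_ge0 (s - x); rewrite sqrrB; nra.
    have -> : 8 * K ^+ 2 * s ^+ 2 + 3 * K ^+ 4 = K ^+ 2 * (8 * s ^+ 2 + 3 * K ^+ 2) by ring.
    apply: ler_pM => //; first exact: sqr_ge0.
      by apply: addr_ge0; apply: mulr_ge0 => //; exact: sqr_ge0.
    by rewrite lerD2l ler_pM2l.
  rewrite ExD; [|by solve_bmeas|by solve_bmeas].
  rewrite ExD; [|by solve_bmeas|by solve_bmeas].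
  rewrite Ex_cst ExZ; last exact: bmeasX.
  have K4 : 0 <= K ^+ 4 by rewrite exprn_ge0.
  have m2 : 8 * K ^+ 2 * \int[P]_w (walk n w ^+ 2) <= 8 * n%:R * K ^+ 4.
    have -> : 8 * n%:R * K ^+ 4 = 8 * K ^+ 2 * (n%:R * K ^+ 2) by ring.
    by rewrite ler_wpM2l ?walk_moment2// mulr_ge0// exprn_ge0.
  apply: le_trans (lerD IH (lerD m2 (lexx _))) _.
  rewrite -[n.+1%:R]natr1; lra.
- move=> i w w' ww'; rewrite (history_walk ww') (psi_hist ww')//.
- by move=> w i iE; rewrite (walkS_basis iE).
Qed.


Section telescoping.
Variables (th a : R) (N M : nat) (phi : T -> R) (C : R).
Hypothesis a_ge0 : 0 <= a.
Hypothesis a2N : a ^+ 2 * N%:R = 1.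
Hypothesis hphi : history M phi.
Hypothesis phiC : forall w, `|phi w| <= C.

(** If the steps of a * walk after time n were independent centred Gaussians of
    variance a^2 q n, this would be the conditional expectation of
    phi * cos (a * walk N + th) given the first n draws. *)
Definition interpolation n w : R :=
  phi w * (cos (a * walk n w + th) * expR (- ((N - n)%:R * (a ^+ 2 / 2 * q n w)))).

Let C_ge0 : 0 <= C.
Proof.
have : P setT != 0%E by rewrite probability_setT gt_eqF// lte01.
move=> PT; have [w _] : [set: T] !=set0.
  by apply/set0P/eqP => T0; move: PT; rewrite T0 measure0 eqxx.
exact: le_trans (phiC w).
Qed.

Let q_ge0 n w : 0 <= q n w.
Proof. by have /andP[] := quad_bound u (psi_prob n w). Qed.

Let aq_ge0 n w : 0 <= a ^+ 2 / 2 * q n w.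
Proof. by rewrite mulr_ge0// divr_ge0// exprn_ge0. Qed.

Let remaining_le n : (n <= N)%N -> a ^+ 2 * (N - n)%:R <= 1.
Proof.
by move=> nN; rewrite -[leRHS]a2N ler_wpM2l ?exprn_ge0// ler_nat leq_subr.
Qed.

Lemma history_interpolation n : (M <= n)%N -> history n (interpolation n).
Proof.
move=> Mn w w' ww'; rewrite /interpolation (history_walk ww') (psi_hist ww').
by rewrite (history_le Mn hphi ww').
Qed.

Let aK : R := a * K.
Let step_error : R := aK ^+ 3 + 2 * aK ^+ 4.

(** Two errors occur: the step of the walk is Gaussian only to third order in a,
    and the conditional variance moves from q n to q n.+1. *)
Lemma interpolation_step n : (M <= n < N)%N ->
  `|\int[P]_w interpolation n.+1 w - \int[P]_w interpolation n w| <=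
  C * (step_error + quad_const * r ^+ n).
Proof.
move=> /andP[Mn nN].
have /andP[r0 r1] := r01.
pose E n w := expR (- ((N - n.+1)%:R * (a ^+ 2 / 2 * q n w))).
(* the interpolation with the conditional variance still frozen at time n *)
pose F w := phi w * (cos (a * walk n.+1 w + th) * E n w).
have E01 w : 0 <= E n w <= 1 by apply: expRN_le1; rewrite mulr_ge0.
have hE : history n (E n) by move=> w w' ww'; rewrite /E (psi_hist ww').
have bI m : (M <= m)%N -> bmeas (interpolation m).
  by move=> Mm; exact: (history_bmeas hurn (history_interpolation Mm)).
have hF : history n.+1 F.
  move=> w w' ww'; rewrite /F (history_walk ww').
  have ww'n j : (j < n)%N -> xi j.+1 w = xi j.+1 w' by move=> jn; exact/ww'/ltnW.
  by rewrite (hE _ _ ww'n) (history_le Mn hphi ww'n).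
have bF := history_bmeas hurn hF.
have Mn1 : (M <= n.+1)%N by exact: leqW.
have frozen : `|\int[P]_w interpolation n.+1 w - \int[P]_w F w| <= C * (quad_const * r ^+ n).
  apply: Ex_dist => [||w]; [exact: bI|exact: bF|].
  rewrite /interpolation /F -!mulrBr !normrM; apply: ler_pM => //.
  rewrite -[leRHS]mul1r; apply: ler_pM => //; first exact: cos_max.
  apply: le_trans (expRN_lipschitz _ _) _; [by rewrite mulr_ge0|by rewrite mulr_ge0|].
  rewrite -mulrBr -mulrBr mulrA normrM ger0_norm; last first.
    by rewrite mulr_ge0// divr_ge0// exprn_ge0.
  have qq : `|q n.+1 w - q n w| <= 2 * (quad_const * r ^+ n).
    have -> : q n.+1 w - q n w = (q n.+1 w - qoo w) - (q n w - qoo w) by ring.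
    apply: le_trans (ler_normB _ _) _; rewrite mulr_natl mulr2n.
    apply: lerD; last exact: quad_rate.
    apply: le_trans (quad_rate _ _) _; rewrite ler_wpM2l ?quad_const_ge0//.
    by rewrite exprS ler_piMl ?exprn_ge0 ?ltW.
  apply: (@le_trans _ _ (1 / 2 * (2 * (quad_const * r ^+ n)))); last first.
    by rewrite le_eqVlt; apply/orP; left; apply/eqP; field.
  apply: ler_pM => //; first by rewrite mulr_ge0// divr_ge0// exprn_ge0.
  by rewrite mulrA ler_pM2r ?invr_gt0// mulrC remaining_le.
have moved : `|\int[P]_w F w - \int[P]_w interpolation n w| <= C * step_error.
  pose G i w := phi w * (cos (a * walk n w + th + a * (u i 0 - dot u (psi n w))) * E n w).
  have hG i : history n (G i).
    move=> w w' ww'; rewrite /G (history_walk ww') (psi_hist ww') (hE _ _ ww').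
    by rewrite (history_le Mn hphi ww').
  rewrite (@expectation_next _ _ _ _ _ _ _ _ _ _ hurn n F G) => [|//|w i iE]; last first.
    rewrite /F /G (walkS_basis iE); congr (_ * (cos _ * _)); ring.
  apply: Ex_dist => [||w]; last 1 first.
  - rewrite (_ : \sum_i _ - _ = phi w * (E n w *
      (\sum_i psi n w i 0 * cos (a * walk n w + th + a * (u i 0 - dot u (psi n w)))
       - cos (a * walk n w + th) * expR (- (a ^+ 2 / 2 * q n w))))).
      rewrite !normrM; apply: ler_pM => //; rewrite -[leRHS]mul1r.
      apply: ler_pM => //; first by have /andP[e0 e1] := E01 w; rewrite ger0_norm.
      by apply: mean_cos_step => //; exact: psi_prob.
    rewrite mulrBr mulrBr; congr (_ - _).
      rewrite [E n w * _]mulr_sumr [phi w * _]mulr_sumr; apply: eq_bigr => i _.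
      by rewrite /G; ring.
    rewrite /interpolation; congr (phi w * _); rewrite [RHS]mulrCA; congr (_ * _).
    rewrite /E -expRD; congr expR.
    have -> : (N - n)%:R = (N - n.+1)%:R + 1 :> R by rewrite natr1 subnSK.
    by ring.
  - apply: bmeas_sum => i; apply: bmeasM; first exact: (urn_psi_bmeas hurn).
    exact: (history_bmeas hurn (hG i)).
  - exact: bI.
apply: le_trans (ler_distD (\int[P]_w F w) _ _) _.
by rewrite mulrDr addrC; exact: lerD.
Qed.

Lemma interpolation_telescope m n : (M <= m)%N -> (m + n <= N)%N ->
  `|\int[P]_w interpolation (m + n) w - \int[P]_w interpolation m w| <=
  C * (n%:R * step_error + quad_const * r ^+ m * \sum_(j < n) r ^+ j).
Proof.
move=> Mm; elim: n => [|n IH] mnN.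
  by rewrite addn0 subrr normr0 big_ord0 mulr0 mul0r addr0 mulr0.
rewrite addnS.
apply: le_trans (ler_distD (\int[P]_w interpolation (m + n) w) _ _) _.
rewrite addrC.
rewrite big_ord_recr /= -natr1.
have -> : C * ((n%:R + 1) * step_error +
    quad_const * r ^+ m * (\sum_(i < n) r ^+ i + r ^+ n)) =
  C * (n%:R * step_error + quad_const * r ^+ m * \sum_(j < n) r ^+ j) +
  C * (step_error + quad_const * r ^+ (m + n)) by rewrite exprD; ring.
apply: lerD; first by apply: IH; rewrite -ltnS -addnS ltnW.
by apply: interpolation_step; rewrite (leq_trans Mm (leq_addr _ _)) -addnS.
Qed.

Definition limit_const : R := quad_const * (1 + (1 - r)^-1).

(** At time N the interpolation is phi * cos (a * walk N + th), and at time m it is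
    close to phi * exp (- q / 2) * cos th.  Letting the variance vary only after
    time m costs O (r ^ m), uniformly in N; the other errors vanish with a. *)
Lemma walk_cos_estimate m : (M <= m <= N)%N -> a <= 1 ->
  `|\int[P]_w (phi w * (cos (a * walk N w + th) - expR (- (qoo w / 2)) * cos th))|
  <= C * (a * (K ^+ 3 + 2 * K ^+ 4 + m%:R * (K + K ^+ 2)) + limit_const * r ^+ m).
Proof.
move=> /andP[Mm mN] a1; have /andP[r0 r1] := r01.
have bqoo : bmeas (fun w => expR (- (qoo w / 2)) * cos th).
  have qcvg w : q n w @[n --> \oo] --> qoo w.
    by apply: (cvg_of_rate r01) => n; exact: quad_rate.
  have mq n : measurable_fun setT (fun w => q n w).
    have hq : history n (fun w => q n w) by move=> w w' ww'; rewrite (psi_hist ww').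
    by case: (history_bmeas hurn hq).
  have mqoo : measurable_fun setT (fun w => qoo w).
    by apply: (measurable_fun_cvg mq) => w _; exact: qcvg.
  apply: bmeasM; last exact: bmeas_cst.
  apply: (@bmeas_le _ _ _ _ 1).
    by do 2 apply: measurableT_comp => //; exact: measurable_funM.
  move=> w; have /andP[qw _] := quad_bound u (psioo_prob w).
  have /andP[e0 e1] : 0 <= expR (- (qoo w / 2)) <= 1 by apply: expRN_le1; rewrite divr_ge0.
  by rewrite ger0_norm.
have bphi := history_bmeas hurn hphi.
have IN w : interpolation N w = phi w * cos (a * walk N w + th).
  by rewrite /interpolation subnn mul0r oppr0 expR0 mulr1.
have bI n : (M <= n)%N -> bmeas (interpolation n).
  by move=> Mn; exact: (history_bmeas hurn (history_interpolation Mn)).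
have MN := leq_trans Mm mN.
have -> : \int[P]_w (phi w * (cos (a * walk N w + th) - expR (- (qoo w / 2)) * cos th)) =
   (\int[P]_w interpolation N w - \int[P]_w interpolation m w) +
   (\int[P]_w interpolation m w - \int[P]_w (phi w * (expR (- (qoo w / 2)) * cos th))).
  rewrite addrA subrK -ExB; [|exact: bI|exact: bmeasM].
  by apply: eq_Rintegral => w _; rewrite IN mulrBr.
apply: le_trans (ler_normD _ _) _.
have tel : `|\int[P]_w interpolation N w - \int[P]_w interpolation m w| <=
    C * (a * (K ^+ 3 + 2 * K ^+ 4) + quad_const * (1 - r)^-1 * r ^+ m).
  rewrite -{1}(subnKC mN); apply: le_trans (interpolation_telescope Mm _) _.
    by rewrite subnKC.
  rewrite ler_wpM2l//; apply: lerD; last first.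
    rewrite mulrAC ler_wpM2r ?exprn_ge0 ?(ltW r0)// ler_wpM2l ?quad_const_ge0//.
    exact: geometric_sum_le.
  have se0 : 0 <= step_error.
    have aK0 : 0 <= aK by exact: mulr_ge0.
    by apply: addr_ge0; [|apply: mulr_ge0 => //]; exact: exprn_ge0.
  apply: (@le_trans _ _ (N%:R * step_error)).
    by rewrite ler_wpM2r// ler_nat leq_subr.
  have -> : N%:R * step_error = (a ^+ 2 * N%:R) * (a * K ^+ 3 + 2 * (a ^+ 2) * K ^+ 4).
    by rewrite /step_error /aK; ring.
  rewrite a2N mul1r.
  have -> : a * (K ^+ 3 + 2 * K ^+ 4) = a * K ^+ 3 + 2 * a * K ^+ 4 by ring.
  rewrite lerD2l ler_wpM2r ?exprn_ge0// ler_pM2l// expr2 ler_piMl//.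
have init : `|\int[P]_w interpolation m w - \int[P]_w (phi w * (expR (- (qoo w / 2)) * cos th))|
    <= C * (a * (m%:R * (K + K ^+ 2)) + quad_const * r ^+ m).
  apply: Ex_dist => [||w]; [exact: bI|exact: bmeasM|].
  rewrite /interpolation -mulrBr normrM; apply: ler_pM => //.
  set e := expR _; set eoo := expR _.
  have q0 := q_ge0 m w.
  have /andP[_ qK] := quad_bound u (psi_prob m w).
  have /andP[qoo0 _] := quad_bound u (psioo_prob w).
  have /andP[e0 e1] : 0 <= e <= 1 by apply: expRN_le1; rewrite mulr_ge0.
  have -> : cos (a * walk m w + th) * e - eoo * cos th =
    (cos (a * walk m w + th) - cos th) * e + (e - eoo) * cos th by ring.
  apply: le_trans (ler_normD _ _) _.
  have h1 : `|(cos (a * walk m w + th) - cos th) * e| <= a * (m%:R * K).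
    rewrite normrM -[leRHS]mulr1; apply: ler_pM => //; last by rewrite ger0_norm.
    apply: le_trans (cos_lipschitz _ _) _; rewrite addrK normrM (ger0_norm a_ge0).
    by rewrite ler_wpM2l// walk_bound.
  have h2 : `|(e - eoo) * cos th| <= a * (m%:R * K ^+ 2) + quad_const * r ^+ m.
    rewrite normrM -[leRHS]mulr1; apply: ler_pM => //; last exact: cos_max.
    apply: le_trans (expRN_lipschitz _ _) _; [by rewrite mulr_ge0|by rewrite divr_ge0|].
    have -> : (N - m)%:R * (a ^+ 2 / 2 * q m w) - qoo w / 2 =
        - (a ^+ 2 * m%:R * q m w / 2) + (q m w - qoo w) / 2.
      rewrite natrB//.
      have -> : (N%:R - m%:R) * (a ^+ 2 / 2 * q m w) =
        (a ^+ 2 * N%:R) * q m w / 2 - a ^+ 2 * m%:R * q m w / 2 by field.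
      by rewrite a2N; field.
    apply: le_trans (ler_normD _ _) _; rewrite normrN; apply: lerD.
      rewrite ger0_norm; last by rewrite divr_ge0 ?mulr_ge0// exprn_ge0.
      apply: (@le_trans _ _ (a ^+ 2 * m%:R * q m w)).
        by rewrite ler_pdivrMr// ler_peMr ?ler1n// !mulr_ge0// exprn_ge0.
      rewrite -mulrA; apply: ler_pM; rewrite ?exprn_ge0 ?mulr_ge0//.
        by rewrite expr2 ler_piMl.
      by rewrite ler_wpM2l.
    rewrite normrM (ger0_norm (_ : 0 <= 2^-1)) ?invr_ge0//.
    rewrite ler_pdivrMr//; apply: le_trans (quad_rate _ _) _.
    by rewrite ler_peMr ?ler1n// mulr_ge0 ?quad_const_ge0// exprn_ge0// ltW.
  apply: le_trans (lerD h1 h2) _.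
  by rewrite le_eqVlt; apply/orP; left; apply/eqP; ring.
apply: le_trans (lerD tel init) _.
by rewrite le_eqVlt; apply/orP; left; apply/eqP; rewrite /limit_const; ring.
Qed.

End telescoping.

End martingale.
(** * Almost sure convergence from summable expectations *)

Section summable.
Context d (T : measurableType d) (R : realType) (P : probability T R).

Lemma ae_cvg0_of_summable (X : nat -> T -> R) (B : R) :
  (forall n, bmeas (X n)) -> (forall n w, 0 <= X n w) ->
  (forall n, \sum_(i < n) \int[P]_w X i w <= B) ->
  {ae P, forall w, X n w @[n --> \oo] --> 0}.
Proof.
move=> bX X0 XB.
have mX n : measurable_fun setT (fun w => (X n w)%:E).
  by apply/measurable_EFinP; case: (bX n).
pose S w := (\sum_(n <oo) (X n w)%:E)%E.
have mS : measurable_fun setT S.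
  by apply: ge0_emeasurable_sum => // n w _ _; rewrite lee_fin.
have S0 w : (0 <= S w)%E by apply: nneseries_ge0 => n _ _; rewrite lee_fin.
have iS : P.-integrable setT S.
  apply/integrableP; split => //.
  rewrite (eq_integral S); last by move=> w _; rewrite gee0_abs.
  rewrite integral_nneseries//; last by move=> n w _; rewrite lee_fin.
  apply: (@le_lt_trans _ _ B%:E); last exact: ltry.
  apply: lime_le.
    by apply: is_cvg_nneseries => n _ _; apply: integral_ge0 => w _; rewrite lee_fin.
  apply: nearW => n; rewrite big_mkord.
  apply: le_trans (_ : ((\sum_(i < n) \int[P]_w X i w)%:E <= _)%E); last by rewrite lee_fin.
  rewrite -sumEFin; apply: lee_sum => i _.
  by rewrite /Rintegral fineK// (integrable_fin_num _ (bmeas_integrable P (bX i))).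
have := integrable_ae measurableT iS; apply: filterS => w /(_ I) Sw.
apply: cvg_series_cvg_0.
apply: nondecreasing_is_cvgn.
  apply/nondecreasing_seqP => n; rewrite /series /= big_nat_recr//= lerDl; exact: X0.
exists (fine (S w)) => _ [n _ <-]; rewrite -lee_fin fineK// /series /= -sumEFin.
by apply: nneseries_lim_ge => i _ _; rewrite lee_fin.
Qed.

Lemma inverse_square_sum_le n : \sum_(i < n) (i.+1%:R ^+ 2)^-1 <= 2 :> R.
Proof.
have h m : \sum_(i < m.+1) (i.+1%:R ^+ 2)^-1 <= 2 - m.+1%:R^-1 :> R.
  elim: m => [|m IH]; first by rewrite big_ord_recr big_ord0 /= expr1n invr1; lra.
  rewrite big_ord_recr /=; apply: le_trans (lerD IH (lexx _)) _.
  have x0 : 0 < m.+1%:R :> R by rewrite ltr0n.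
  rewrite -[m.+2%:R]natr1; move: (m.+1%:R : R) x0 => x x0.
  have x1 : 0 < x + 1 by rewrite addr_gt0.
  have -> : 2 - (x + 1)^-1 = 2 - x^-1 + ((x + 1) ^+ 2)^-1 + (x * (x + 1) ^+ 2)^-1.
    by field; rewrite !gt_eqF.
  by rewrite lerDl invr_ge0 mulr_ge0 ?sqr_ge0// ltW.
case: n => [|n]; first by rewrite big_ord0.
by apply: le_trans (h n) _; rewrite gerBl invr_ge0.
Qed.

End summable.

(** * The covariance matrix of one draw *)

Lemma delta_l1 (R : realType) (k : nat) (i : 'I_k) : l1 (delta_mx i 0 : 'cV[R]_k) = 1.
Proof.
rewrite /l1 (bigD1 i)//= big1 ?addr0 ?mxE ?eqxx ?normr1// => j ji.
by rewrite mxE (negbTE ji) normr0.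
Qed.

Section multinomial_covariance.
Context (R : realType) (k : nat) (p : 'cV[R]_k).
Hypothesis pp : prob_vector p.
Local Notation S := (diag_mx p^T - p *m p^T).

Lemma covarianceE i j : S i j = (i == j)%:R * p i 0 - p i 0 * p j 0.
Proof. by rewrite !mxE big_ord1 !mxE mulr_natl; case: eqVneq => [->|]. Qed.

(** The witness is diag (sqrt p) - p (sqrt p)^T: its square is as wanted because
    the vector sqrt p has norm 1. *)
Lemma covariance_root : exists A : 'M[R]_k, A *m A^T = S.
Proof.
have [p0 p1] := pp; pose s i := Num.sqrt (p i 0).
have ss i : s i ^+ 2 = p i 0 by rewrite sqr_sqrtr.
exists (\matrix_(i, j) ((i == j)%:R * s i - p i 0 * s j)).
apply/matrixP => i l; rewrite covarianceE mxE.
rewrite (eq_bigr (fun j => (j == i)%:R * ((j == l)%:R * (s i * s l) - s i * p l 0 * s j)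
   + ((j == l)%:R * (- (p i 0 * s j * s l)) + p i 0 * p l 0 * p j 0))); last first.
  move=> j _; rewrite !mxE -[p j 0]ss [i == j]eq_sym [l == j]eq_sym; ring.
have pick m (f : 'I_k -> R) : \sum_j (j == m)%:R * f j = f m.
  rewrite (bigD1 m)//= big1 ?addr0 ?eqxx ?mul1r// => j /negbTE ->.
  by rewrite mul0r.
rewrite !big_split/= !pick -mulr_sumr p1.
have sp m : s m * s m = p m 0 by rewrite -expr2.
have [->|il] := eqVneq i l; rewrite -!sp /=; ring.
Qed.

Lemma covariance_diag i : S i i <= 1.
Proof.
have [p0 p1] := pp; rewrite covarianceE eqxx mul1r.
apply: (@le_trans _ _ (p i 0)); first by rewrite gerBl mulr_ge0.
by rewrite -p1 (bigD1 i)//= lerDl; apply: sumr_ge0.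
Qed.

Lemma covariance_quad u : dot u (S *m u) = quad u p.
Proof.
rewrite mulmxBl dotBr /quad; congr (_ - _).
  apply: eq_bigr => i _; rewrite mul_diag_mx !mxE; ring.
rewrite -mulmxA (_ : p^T *m u = (dot u p)%:M).
  by rewrite mul_mx_scalar dotZr -expr2.
apply/matrixP => i j; rewrite !ord1 !mxE mulr1n dotE.
by apply: eq_bigr => l _; rewrite mxE.
Qed.

End multinomial_covariance.

(** * Stable convergence tested on cosines *)

Section limit_theorems.
Context d (T : measurableType d) (R : realType) (P : probability T R) (k : nat).
Variables (alpha beta : R) (b0 B0 : 'cV[R]_k) (xi : nat -> {RV P >-> 'cV[R]_k}).
Hypothesis alpha_gt0 : 0 < alpha.
Hypothesis beta_gt1 : 1 < beta.
Hypothesis hurn : rescaled_polya_urn alpha beta b0 B0 xi.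

Local Notation r := beta^-1.
Local Notation psi := (urn_psi alpha beta b0 B0 xi).
Local Notation psioo := (psi_infty alpha beta B0 xi).
Local Notation walk := (walk alpha beta b0 B0 xi).
Local Notation history := (history xi).
Local Notation Cpsi := (psi_const alpha beta b0 B0).

Let r01 : 0 < r < 1 := urn_rate01 beta_gt1.
Let Cpsi_ge0 : 0 <= Cpsi. Proof. exact: psi_const_ge0 alpha_gt0 beta_gt1 hurn. Qed.

Definition scale n : R := (Num.sqrt n%:R)^-1.

Lemma scale_ge0 n : 0 <= scale n. Proof. by rewrite invr_ge0 sqrtr_ge0. Qed.

Lemma scale_sqr n : (0 < n)%N -> scale n ^+ 2 * n%:R = 1.
Proof.
move=> n0; rewrite exprVn sqr_sqrtr// mulVf// gt_eqF// ltr0n//.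
Qed.

Lemma scale_le1 n : scale n <= 1.
Proof.
case: n => [|n]; first by rewrite /scale sqrtr0 invr0.
by rewrite invf_le1 ?sqrtr_gt0// -[leLHS]sqrtr1 ler_wsqrtr// ler1n.
Qed.

Lemma cvg_scale (c : R) : c * scale n @[n --> \oo] --> 0.
Proof.
apply/cvg0P => e e0; exists (Num.truncn ((`|c| / e) ^+ 2)).+1 => n cn.
have n0 : 0 < n%:R :> R by rewrite ltr0n; case: (n) cn.
have : (`|c| / e) ^+ 2 <= n%:R.
  by apply: le_trans (ltW (truncnS_gt _)) _; rewrite ler_nat.
rewrite -{1}(sqr_sqrtr (ltW n0)) ler_pXn2r ?nnegrE ?sqrtr_ge0 ?divr_ge0 ?(ltW e0)//.
by rewrite normrM (ger0_norm (scale_ge0 n)) !ler_pdivrMr ?sqrtr_gt0// mulrC.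
Qed.

Lemma norm_le_of_dist (x y a b : R) : `|x - y| <= a -> `|y| <= b -> `|x| <= a + b.
Proof.
by move=> xy yb; rewrite -(subrK y x); apply: le_trans (ler_normD _ _) _; exact: lerD.
Qed.

Section cosine_test.
Variables (u : 'cV[R]_k) (th : R).
Local Notation qoo w := (quad u (psioo w)).

(** By the formula for the Gaussian mean of a cosine, the second term is the mean
    under the law N (0, Sigma2 w), for which qoo w is the variance of dot u. *)
Definition deviation n w : R :=
  cos (scale n * walk u n w + th) - expR (- (qoo w / 2)) * cos th.

(** With psi M in place of its limit the deviation depends on finitely many draws
    only. *)
Definition deviation_approx n M w : R :=
  cos (scale n * walk u n w + th) - expR (- (quad u (psi M w) / 2)) * cos th.

Let rate : R := quad_const alpha beta b0 B0 u.
Let rate_ge0 : 0 <= rate. Proof. exact: quad_const_ge0 alpha_gt0 beta_gt1 hurn u. Qed.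

Let exp_cos_le1 (x : R) : 0 <= x -> `|expR (- (x / 2)) * cos th| <= 1.
Proof.
move=> x0; have /andP[e0 e1] : 0 <= expR (- (x / 2)) <= 1.
  by apply: expRN_le1; rewrite divr_ge0.
by rewrite normrM -[leRHS]mulr1; apply: ler_pM => //; [rewrite ger0_norm|exact: cos_max].
Qed.

Lemma deviation_approx_bound n M w : `|deviation_approx n M w| <= 2.
Proof.
apply: le_trans (ler_normB _ _) _; rewrite -[2]/(1 + 1); apply: lerD; first exact: cos_max.
apply: exp_cos_le1.
by have /andP[] := quad_bound u (psi_prob alpha_gt0 beta_gt1 hurn M w).
Qed.

Lemma deviation_bound n w : `|deviation n w| <= 2.
Proof.
apply: le_trans (ler_normB _ _) _; rewrite -[2]/(1 + 1); apply: lerD; first exact: cos_max.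
apply: exp_cos_le1.
by have /andP[] := quad_bound u (psioo_prob alpha_gt0 beta_gt1 hurn w).
Qed.

Lemma deviation_approx_rate n M w :
  `|deviation n w - deviation_approx n M w| <= rate * r ^+ M.
Proof.
have /andP[q0 _] := quad_bound u (psioo_prob alpha_gt0 beta_gt1 hurn w).
have /andP[qM0 _] := quad_bound u (psi_prob alpha_gt0 beta_gt1 hurn M w).
have -> : deviation n w - deviation_approx n M w =
  (expR (- (quad u (psi M w) / 2)) - expR (- (qoo w / 2))) * cos th.
  rewrite /deviation /deviation_approx.
  by move: (expR _) (expR _) (cos th) (cos _) => *; ring.
rewrite normrM -[leRHS]mulr1; apply: ler_pM => //; last exact: cos_max.
apply: le_trans (expRN_lipschitz _ _) _; [by rewrite divr_ge0|by rewrite divr_ge0|].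
rewrite -mulrBl normrM (@ger0_norm _ 2^-1) ?invr_ge0// ler_pdivrMr//.
apply: le_trans (quad_rate alpha_gt0 beta_gt1 hurn u M w) _.
have /andP[r0 _] := r01.
by rewrite ler_peMr ?ler1n// mulr_ge0// exprn_ge0// ltW.
Qed.

Lemma history_deviation_approx n M : (n <= M)%N -> history M (deviation_approx n M).
Proof.
move=> nM w w' ww'; rewrite /deviation_approx.
rewrite (history_le nM (@history_walk _ _ _ _ _ alpha beta b0 B0 xi u n) ww').
by rewrite (history_urn_psi alpha beta b0 B0 ww').
Qed.

Lemma measurable_deviation n : measurable_fun setT (deviation n).
Proof.
apply: (@measurable_fun_cvg _ _ _ _ (fun M => deviation_approx n (n + M))) => [M|w _].
  have [] // := history_bmeas hurn (history_deviation_approx (leq_addr M n)).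
apply: (@cvg_of_rate _ _ r01 _ _ (rate * r ^+ n)) => M.
by rewrite distrC -mulrA -exprD; exact: deviation_approx_rate.
Qed.

Let bdev n : bmeas (deviation n) :=
  bmeas_le (measurable_deviation n) (deviation_bound n).

Lemma history_deviation_cvg M phi C : history M phi -> (forall w, `|phi w| <= C) ->
  \int[P]_w (phi w * deviation n w) @[n --> \oo] --> 0.
Proof.
move=> hphi phiC; apply/cvg0P => e e0.
have e20 : 0 < e / 2 by rewrite divr_gt0.
have [m0 hm0] := (cvg0P _).1 (cvg_rate r01 (C * limit_const alpha beta b0 B0 u)) _ e20.
pose m := maxn M m0.
pose c := C * ((2 * l1 u) ^+ 3 + 2 * (2 * l1 u) ^+ 4 + m%:R * (2 * l1 u + (2 * l1 u) ^+ 2)).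
have [n0 hn0] := (cvg0P _).1 (cvg_scale c) _ e20.
exists (maxn m (maxn n0 1)) => n nn.
have mn : (m <= n)%N := leq_trans (leq_maxl _ _) nn.
have nn' := leq_trans (leq_maxr _ _) nn.
have n0n : (n0 <= n)%N := leq_trans (leq_maxl _ _) nn'.
have n1 : (0 < n)%N := leq_trans (leq_maxr _ _) nn'.
have Mmn : (M <= m <= n)%N by apply/andP; split => //; exact: leq_maxl.
apply: le_trans (walk_cos_estimate alpha_gt0 beta_gt1 hurn u th (scale_ge0 n)
  (scale_sqr n1) hphi phiC Mmn (scale_le1 n)) _.
rewrite mulrDr [leRHS](splitr e); apply: lerD.
  by apply: le_trans (hn0 n n0n); rewrite mulrCA mulrC; exact: ler_norm.
have /hm0 : (m0 <= m)%N by exact: leq_maxr.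
by apply: le_trans; rewrite mulrA; exact: ler_norm.
Qed.

(** Each deviation is a uniform limit of functions of finitely many draws, to which
    the later deviations become orthogonal by the previous lemma. *)
Lemma deviation_weak_cvg0 (Z : T -> R) : bmeas Z ->
  \int[P]_w (Z w * deviation n w) @[n --> \oo] --> 0.
Proof.
apply: (weak_cvg0_of_orthogonal measurable_deviation deviation_bound) => j.
apply/cvg0P => e e0; have e20 : 0 < e / 2 by rewrite divr_gt0.
have [M0 hM0] := (cvg0P _).1 (cvg_rate r01 (2 * rate)) _ e20.
pose M := maxn j M0.
have jM : (j <= M)%N by exact: leq_maxl.
have hphi := history_deviation_approx jM.
have bphi := history_bmeas hurn hphi.
have [N hN] := (cvg0P _).1 (history_deviation_cvg hphi (deviation_approx_bound j M)) _ e20.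
exists N => n Nn; rewrite [leRHS](splitr e).
apply: (@norm_le_of_dist _ (\int[P]_w (deviation_approx j M w * deviation n w)));
  last exact: hN.
apply: (Ex_dist P (bmeasM (bdev j) (bdev n)) (bmeasM bphi (bdev n))) => w.
rewrite -mulrBl normrM.
apply: (@le_trans _ _ (rate * r ^+ M * 2)).
  by apply: ler_pM => //; [exact: deviation_approx_rate|exact: deviation_bound].
have /hM0 : (M0 <= M)%N by exact: leq_maxr.
apply: le_trans; rewrite mulrC mulrA; exact: ler_norm.
Qed.

(** Perturbations of order N ^ (-1/2) of the walk do not change the limit. *)
Lemma cos_stable_cvg (Y : nat -> T -> 'cV[R]_k) (c : R) (Z : T -> R) :
  (forall n, measurable_fun setT (Y n)) ->
  (forall n w, `|dot u (Y n w) - scale n * walk u n w| <= c * scale n) ->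
  bmeas Z ->
  \int[P]_w (Z w * cos (dot u (Y n w) + th)) @[n --> \oo] -->
  \int[P]_w (Z w * (expR (- (qoo w / 2)) * cos th)).
Proof.
move=> mY Yc bZ; have [mZ [D ZD]] := bZ.
have bcos n : bmeas (fun w => cos (dot u (Y n w) + th)).
  apply: bmeas_cos; apply: measurable_funD => //.
  exact: measurableT_comp (measurable_dot u) (mY n).
have bwalk n : bmeas (fun w => cos (scale n * walk u n w + th)).
  apply: bmeas_cos; apply: measurable_funD => //; apply: measurable_funM => //.
  by case: (walk_bmeas hurn u n).
have bexp : bmeas (fun w => expR (- (qoo w / 2)) * cos th).
  rewrite (_ : (fun w => _) = fun w => cos (scale 0 * walk u 0 w + th) - deviation 0 w).
    exact: bmeasB.
  by apply/funext => w; rewrite /deviation subKr.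
apply/subr_cvg0/cvg0P => e e0; have e20 : 0 < e / 2 by rewrite divr_gt0.
have [N1 hN1] := (cvg0P _).1 (deviation_weak_cvg0 bZ) _ e20.
have [N2 hN2] := (cvg0P _).1 (cvg_scale (D * c)) _ e20.
exists (maxn N1 N2) => n; rewrite geq_max => /andP[N1n N2n].
apply: le_trans (ler_distD (\int[P]_w (Z w * cos (scale n * walk u n w + th))) _ _) _.
rewrite [leRHS](splitr e); apply: lerD.
  apply: Ex_dist => [||w]; [exact: bmeasM|exact: bmeasM|].
  rewrite -mulrBr normrM; apply: (@le_trans _ _ (D * (c * scale n))).
    apply: ler_pM => //; apply: le_trans (cos_lipschitz _ _) _.
    rewrite (_ : _ + th - _ = dot u (Y n w) - scale n * walk u n w); first exact: Yc.
    by move: (dot _ _) (scale n * _) => *; ring.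
  by rewrite mulrA; apply: le_trans (ler_norm _) _; exact: hN2.
have := hN1 n N1n; rewrite -ExB; [|exact: bmeasM|exact: bmeasM].
by under eq_Rintegral do rewrite mulrBr.
Qed.

End cosine_test.

End limit_theorems.
(** * The limit theorems *)

Section assembly.
Context d (T : measurableType d) (R : realType) (P : probability T R) (k : nat).
Variables (alpha beta : R) (b0 B0 : 'cV[R]_k) (xi : nat -> {RV P >-> 'cV[R]_k}).
Hypothesis alpha_gt0 : 0 < alpha.
Hypothesis beta_gt1 : 1 < beta.
Hypothesis hurn : rescaled_polya_urn alpha beta b0 B0 xi.

Local Notation r := beta^-1.
Local Notation psi := (urn_psi alpha beta b0 B0 xi).
Local Notation psioo := (psi_infty alpha beta B0 xi).
Local Notation walk := (walk alpha beta b0 B0 xi).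
Local Notation Cpsi := (psi_const alpha beta b0 B0).

Let r01 : 0 < r < 1 := urn_rate01 beta_gt1.
Let Cpsi_ge0 : 0 <= Cpsi. Proof. exact: psi_const_ge0 alpha_gt0 beta_gt1 hurn. Qed.
Let psi_rate := urn_psi_rate alpha_gt0 beta_gt1 hurn.
Let psioo_pv := psioo_prob alpha_gt0 beta_gt1 hurn.

Lemma psi_dist j n w i : (j <= n)%N -> `|psi j w i 0 - psi n w i 0| <= 2 * Cpsi * r ^+ j.
Proof.
move=> jn; have /andP[r0 r1] := r01.
apply: le_trans (ler_distD (psioo w i 0) _ _) _.
have -> : 2 * Cpsi * r ^+ j = Cpsi * r ^+ j + Cpsi * r ^+ j by ring.
apply: lerD; first exact: psi_rate.
rewrite distrC; apply: le_trans (psi_rate n w i) _.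
by rewrite ler_wpM2l// ler_wiXn2l// ltW.
Qed.

Lemma psioo_dist j w i : `|psi j w i 0 - psioo w i 0| <= 2 * Cpsi * r ^+ j.
Proof.
have /andP[r0 r1] := r01.
apply: le_trans (psi_rate j w i) _; rewrite ler_wpM2r ?exprn_ge0 ?(ltW r0)//.
by rewrite ler_peMl// ler1n.
Qed.

Lemma psioo_bmeas i : bmeas (fun w => psioo w i 0).
Proof.
apply: (@bmeas_le _ _ _ _ 1).
  apply: (@measurable_fun_cvg _ _ _ _ (fun n w => psi n w i 0)) => [n|w _].
    by case: (urn_psi_bmeas hurn n i).
  by apply: (cvg_of_rate r01) => n; exact: psi_rate.
move=> w; have [p0 p1] := psioo_pv w; rewrite ger0_norm//.
by rewrite -p1 (bigD1 i)//= lerDl; apply: sumr_ge0.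
Qed.

Let dot_mean u n w : dot u (xi_mean xi n w) = n%:R^-1 * \sum_(j < n) dot u (xi j.+1 w).
Proof.
rewrite /xi_mean dotZr big_add1 /= big_mkord; congr (_ * _).
apply: (big_morph (dot u)) => [x y|]; first exact: dotDr.
by rewrite dotE big1// => i _; rewrite mxE mul0r.
Qed.

Lemma mean_deviation u n w (v : 'cV[R]_k) : (0 < n)%N ->
  dot u (xi_mean xi n w - v) =
  n%:R^-1 * (walk u n w + \sum_(j < n) (dot u (psi j w) - dot u v)).
Proof.
move=> n0; have n0' : n%:R != 0 :> R by rewrite pnatr_eq0 -lt0n.
rewrite dotBr dot_mean /walk -big_split/=.
under [X in _ = _ * X]eq_bigr do rewrite addrA subrK.
rewrite sumrB sumr_const card_ord mulrBr -[dot u v *+ n]mulr_natl; congr (_ - _).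
by rewrite mulrA mulVf// mul1r.
Qed.

Definition drift_const (u : 'cV[R]_k) : R := l1 u * (2 * Cpsi * (1 - r)^-1).

Lemma drift_const_ge0 u : 0 <= drift_const u.
Proof.
have /andP[r0 r1] := r01.
apply: mulr_ge0; first exact: l1_ge0.
by apply: mulr_ge0; [exact: mulr_ge0|rewrite invr_ge0 subr_ge0 ltW].
Qed.

(** Since the errors of psi are summable, replacing every psi by its limit
    costs a bounded amount in the sum over all draws. *)
Lemma drift_bound u n w (v : 'cV[R]_k) :
  (forall j i, (j < n)%N -> `|psi j w i 0 - v i 0| <= 2 * Cpsi * r ^+ j) ->
  `|\sum_(j < n) (dot u (psi j w) - dot u v)| <= drift_const u.
Proof.
move=> hv; apply: le_trans (ler_norm_sum _ _ _) _.
apply: (@le_trans _ _ (\sum_(j < n) l1 u * (2 * Cpsi * r ^+ j))).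
  by apply: ler_sum => j _; apply: dot_lipschitz => i; exact: hv.
rewrite -mulr_sumr -mulr_sumr; apply: ler_wpM2l; first exact: l1_ge0.
by apply: ler_wpM2l; [exact: mulr_ge0|exact: geometric_sum_le].
Qed.

(* psi and its limit are the two centrings v of the empirical mean *)
Section target.
Variable v : nat -> T -> 'cV[R]_k.
Hypothesis bv : forall n i, bmeas (fun w => v n w i 0).
Hypothesis hv : forall n w j i, (j < n)%N ->
  `|psi j w i 0 - v n w i 0| <= 2 * Cpsi * r ^+ j.

Let Y n w : 'cV[R]_k := Num.sqrt (n%:R : R) *: (xi_mean xi n w - v n w).

Let dot_Y u n w : `|dot u (Y n w) - scale R n * walk u n w| <= drift_const u * scale R n.
Proof.
case: n => [|n].
  rewrite /Y /scale sqrtr0 scale0r invr0 mul0r mulr0 subr0 dotE big1 ?normr0//.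
  by move=> i _; rewrite mxE mul0r.
have n0 : 0 < n.+1%:R :> R by rewrite ltr0n.
have s0 : 0 < Num.sqrt n.+1%:R :> R by rewrite sqrtr_gt0.
rewrite /Y dotZr mean_deviation//.
set W := walk u _ w; set D := \sum_(j < _) _.
have -> : Num.sqrt n.+1%:R * (n.+1%:R^-1 * (W + D)) - scale R n.+1 * W = D * scale R n.+1.
  rewrite /scale -{2}(sqr_sqrtr (ltW n0)).
  move: (Num.sqrt _) s0 => s s0; move: W D => W D.
  by field; rewrite gt_eqF.
rewrite normrM (ger0_norm (scale_ge0 R n.+1)) ler_wpM2r ?scale_ge0//.
by apply: drift_bound => j i jn; exact: hv.
Qed.

Let bY n i : bmeas (fun w => Y n w i 0).
Proof.
rewrite (_ : (fun w => _) = fun w =>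
  Num.sqrt n%:R * (n%:R^-1 * (\sum_(j < n) xi j.+1 w i 0) - v n w i 0)).
  apply: bmeasZ; apply: bmeasB => //; apply: bmeasZ; apply: bmeas_sum => j.
  exact: (draw_bmeas hurn).
apply/funext => w; rewrite /Y -dot_delta dotZr dotBr dot_mean !dot_delta.
by under eq_bigr do rewrite dot_delta.
Qed.

Lemma stable_cvg_mean : stable_cvg_gaussian P Y (Sigma2 alpha beta B0 xi).
Proof.
have mY n : measurable_fun setT (Y n).
  by apply: measurable_colvecP => i; case: (bY n i).
apply: (@stable_cvg_of_cos _ _ _ _ _ _ _ (8 + 2 * (2 * Cpsi * (1 - r)^-1) ^+ 2)).
- exact: bY.
- move=> i j; rewrite (_ : (fun w => _) = fun w =>
    (i == j)%:R * psioo w i 0 - psioo w i 0 * psioo w j 0); last first.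
    by apply/funext => w; rewrite /Sigma2 covarianceE.
  have [mi _] := psioo_bmeas i; have [mj _] := psioo_bmeas j.
  by apply: measurable_funB; exact: measurable_funM.
- by move=> w; exact: covariance_root.
- by move=> w i; apply: covariance_diag; exact: psioo_pv.
- move=> n i.
  have bw := walk_bmeas hurn (delta_mx i 0) n.
  pose D := drift_const (delta_mx i 0 : 'cV[R]_k).
  have DE : D = 2 * Cpsi * (1 - r)^-1 by rewrite /D /drift_const delta_l1 mul1r.
  rewrite -DE.
  apply: (@le_trans _ _ (\int[P]_w
      (2 * scale R n ^+ 2 * walk (delta_mx i 0) n w ^+ 2 + 2 * D ^+ 2))).
    apply: Ex_le; [exact: bmeasX|by solve_bmeas|move=> w].
    have := dot_Y (delta_mx i 0) n w; rewrite dot_delta -/D.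
    set y := Y n w i 0; set x := scale R n * _ => yx.
    have D0 : 0 <= D := drift_const_ge0 _.
    have yxD : `|y - x| <= D.
      by apply: le_trans yx _; rewrite ler_piMr// scale_le1.
    have : (y - x) ^+ 2 <= D ^+ 2.
      by rewrite -(real_normK (num_real (y - x))) lerXn2r ?nnegrE.
    have := sqr_ge0 (y - 2 * x).
    have -> : 2 * scale R n ^+ 2 * walk (delta_mx i 0) n w ^+ 2 = 2 * x ^+ 2.
      by rewrite /x; ring.
    move: y x D {yx yxD D0 DE} => y x D; nra.
  rewrite ExD; [|by solve_bmeas|by solve_bmeas].
  rewrite Ex_cst ExZ; last exact: bmeasX.
  rewrite lerD2r.
  case: n bw => [|n] bw.
    by rewrite /scale sqrtr0 invr0 expr0n mulr0 mul0r.
  apply: (@le_trans _ _ (2 * scale R n.+1 ^+ 2 * (n.+1%:R * (2 * 1) ^+ 2))).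
    rewrite ler_wpM2l ?mulr_ge0 ?exprn_ge0 ?scale_ge0//.
    have := walk_moment2 alpha_gt0 beta_gt1 hurn (delta_mx i 0) n.+1.
    by rewrite delta_l1.
  rewrite (_ : _ * _ = 8 * (scale R n.+1 ^+ 2 * n.+1%:R)); last by ring.
  by rewrite scale_sqr// mulr1.
move=> u th Z bZ.
have covE w : dot u (Sigma2 alpha beta B0 xi w *m u) = quad u (psioo w).
  exact: covariance_quad.
under eq_Rintegral do rewrite covE.
exact: (cos_stable_cvg alpha_gt0 beta_gt1 hurn mY (dot_Y u) bZ).
Qed.

End target.

(** The fourth moment of the walk is of order n^2, hence that of its average is
    summable. *)
Lemma walk_average_cvg0 u :
  {ae P, forall w, n.+1%:R^-1 * walk u n.+1 w @[n --> \oo] --> 0}.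
Proof.
pose X n w := (n.+1%:R^-1 * walk u n.+1 w) ^+ 4.
have bX n : bmeas (X n).
  by apply: bmeasX; apply: bmeasZ; exact: (walk_bmeas hurn).
have K4 : 0 <= 4 * (2 * l1 u) ^+ 4.
  by apply: mulr_ge0 => //; apply: exprn_ge0; apply: mulr_ge0 => //; exact: l1_ge0.
have := @ae_cvg0_of_summable _ _ _ P X (4 * (2 * l1 u) ^+ 4 * 2) bX.
move=> /(_ _ _)[].
- by move=> n w; rewrite /X -[4%N]/(2 * 2)%N exprM sqr_ge0.
- move=> n; apply: (@le_trans _ _ (\sum_(i < n) 4 * (2 * l1 u) ^+ 4 * (i.+1%:R ^+ 2)^-1)).
    apply: ler_sum => i _; rewrite /X.
    under eq_Rintegral do rewrite exprMn.
    rewrite ExZ; last by apply: bmeasX; exact: (walk_bmeas hurn).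
    have i0 : 0 < i.+1%:R :> R by rewrite ltr0n.
    rewrite exprVn ler_pdivrMl ?exprn_gt0//.
    apply: le_trans (walk_moment4 alpha_gt0 beta_gt1 hurn u i.+1) _.
    rewrite le_eqVlt; apply/orP; left; apply/eqP.
    by move: (i.+1%:R : R) i0 => x x0; field; rewrite gt_eqF.
  by rewrite -mulr_sumr ler_wpM2l// inverse_square_sum_le.
move=> N [mN PN XN]; exists N; split => // w nw; apply: XN => /= Xw; apply: nw => /=.
apply/cvg0P => e e0; have [n0 hn0] := (cvg0P _).1 Xw (e ^+ 4) (exprn_gt0 4 e0).
exists n0 => n nn; have := hn0 n nn.
by rewrite /X normrX ler_pXn2r// nnegrE ltW.
Qed.

Lemma mean_cvg : {ae P, forall w, xi_mean xi n w @[n --> \oo] --> psioo w}.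
Proof.
have : {ae P, forall w i, n.+1%:R^-1 * walk (delta_mx i 0) n.+1 w @[n --> \oo] --> 0}.
  by apply: filter_forall => i; exact: walk_average_cvg0.
apply: filterS => w hw; rewrite -cvg_shiftS; apply: cvg_col => i.
apply/subr_cvg0.
pose D n : R := \sum_(j < n.+1)
  (dot (delta_mx i 0) (psi j w) - dot (delta_mx i 0) (psioo w)).
have -> : (fun n => xi_mean xi n.+1 w i 0 - psioo w i 0) =
    (fun n => n.+1%:R^-1 * walk (delta_mx i 0) n.+1 w + n.+1%:R^-1 * D n).
  apply/funext => n; rewrite -mulrDr -mean_deviation//.
  by rewrite dot_delta !mxE.
rewrite -[X in _ --> X](addr0 0); apply: cvgD; first exact: hw.
apply/cvg0P => e e0; pose C := drift_const (delta_mx i 0 : 'cV[R]_k).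
exists (Num.truncn (C / e)) => n Cn.
have n0 : 0 < n.+1%:R :> R by rewrite ltr0n.
rewrite normrM (@ger0_norm _ n.+1%:R^-1) ?invr_ge0// ler_pdivrMl//.
apply: (@le_trans _ _ C).
  by apply: drift_bound => j l _; exact: psioo_dist.
rewrite -ler_pdivrMr//; apply: le_trans (ltW (truncnS_gt _)) _.
by rewrite ler_nat.
Qed.

End assembly.

Unset Implicit Arguments.

Theorem theorem3p6 (d : measure_display) (T : measurableType d) (R : realType)
    (P : probability T R) (k : nat) (hk : (2 <= k)%N)
    (alpha beta : R) (halpha : 0 < alpha) (hbeta : 1 < beta)
    (b0 B0 : 'cV[R]_k) (xi : nat -> {RV P >-> 'cV[R]_k})
    (hurn : rescaled_polya_urn alpha beta b0 B0 xi) :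
  [/\ {ae P, forall w, urn_psi alpha beta b0 B0 xi N w @[N --> \oo] -->
                       psi_infty alpha beta B0 xi w},
      {ae P, forall w, xi_mean xi N w @[N --> \oo] -->
                       psi_infty alpha beta B0 xi w},
      stable_cvg_gaussian P
        (fun N w => Num.sqrt (N%:R : R) *:
           (xi_mean xi N w - urn_psi alpha beta b0 B0 xi N w))
        (Sigma2 alpha beta B0 xi) &
      stable_cvg_gaussian P
        (fun N w => Num.sqrt (N%:R : R) *:
           (xi_mean xi N w - psi_infty alpha beta B0 xi w))
        (Sigma2 alpha beta B0 xi)].
Proof.
split.
- apply: aeW => w; exact: (urn_psi_cvg halpha hbeta hurn).
- exact: (mean_cvg halpha hbeta hurn).
- apply: (stable_cvg_mean halpha hbeta hurn (v := urn_psi alpha beta b0 B0 xi)).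
  + by move=> n i; exact: (urn_psi_bmeas hurn).
  + by move=> n w j i jn; apply: (psi_dist halpha hbeta hurn); exact: ltnW.
- apply: (stable_cvg_mean halpha hbeta hurn (v := fun=> psi_infty alpha beta B0 xi)).
  + by move=> n i; exact: (psioo_bmeas halpha hbeta hurn).
  + by move=> n w j i _; exact: (psioo_dist halpha hbeta hurn).
Qed.
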